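(* Fix an integer $d \geq 1$. A non-empty set $\Gamma \subset \mathbb{Z}^d$ satisfies the strict majorant property on $L^p([0,1]^d)$ for all $p>0$ if and only if $\Gamma$ is affinely independent. Furthermore, whenever $\Gamma \subset \mathbb{Z}^d$ is not affinely independent, there exist an integer $m \ge 0$ and real coefficients $(a_n)_{n \in \Gamma}$ such that for every $p \in (2m,2m+2)$, $$\left\| \sum_{n \in \Gamma} |a_n| e(n \cdot x) \right\|_{L^p([0,1]^d)} < \left\| \sum_{n \in \Gamma} a_n e(n \cdot x) \right\|_{L^p([0,1]^d)}.$$ In particular, this last assertion (existence of $m$ and $(a_n)_{n\in\Gamma}$) holds for every set $\Gamma \subset \mathbb{Z}^d$ of cardinality at least $d + 2$.
   Context: Notation: $e(\theta) := e^{2\pi i \theta}$ for $\theta\in\mathbb{R}$; $\|f\|_{L^p([0,1]^d)} := \big(\int_{[0,1]^d}|f(x)|^p\,dx\big)^{1/p}$ for every real $p>0$ (only a quasi-norm when $p<1$). A set $\Gamma\subset\mathbb{Z}^d$ (finite or infinite) satisfies the strict majorant property on $L^p([0,1]^d)$ if for all choices of real coefficients $(a_n)_{n\in\Gamma}$, $(A_n)_{n\in\Gamma}$ with $|a_n|\le A_n$ for every $n\in\Gamma$, $$\Big\| \sum_{n\in\Gamma} a_n e(n\cdot x) \Big\|_{L^p([0,1]^d)}\le \Big\| \sum_{n\in\Gamma} A_n e(n\cdot x) \Big\|_{L^p([0,1]^d)}.$$ When $\Gamma$ is infinite, coefficient families indexed by $\Gamma$ are understood to have only finitely many nonzero entries.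 A set $\Gamma\subset\mathbb{Z}^d$ is affinely independent if for any $n_0\in\Gamma$ the set $\{n-n_0 : n\in\Gamma, n\neq n_0\}$ is linearly independent. *)

(* Defs.v *)
From HB Require Import structures.
From mathcomp Require Import all_boot all_order all_algebra.
From mathcomp Require Import all_classical all_reals all_analysis.
From mathcomp Require Import complex.

Set Implicit Arguments.
Unset Strict Implicit.
Unset Printing Implicit Defensive.

Import Order.TTheory GRing.Theory Num.Theory.
Import numFieldNormedType.Exports.

Local Open Scope classical_set_scope.
Local Open Scope ring_scope.

(* Re-proved because the library instance is shadowed by the one for
   subprobabilities and is not inferred. *)
Lemma sigma_finite_product d1 d2 (T1 : measurableType d1)
    (T2 : measurableType d2) (R : realType)
    (m1 : {sigma_finite_measure set T1 -> \bar R})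
    (m2 : {sigma_finite_measure set T2 -> \bar R}) :
  sigma_finite setT (m1 \x m2)%E.
Proof.
have /sigma_finiteP[F [TF ndF Foo]] := sigma_finiteT m1.
have /sigma_finiteP[G [TG ndG Goo]] := sigma_finiteT m2.
exists (fun n => F n `*` G n).
  rewrite -setXTT TF TG predeqE => -[x y]; split.
    move=> [/= [n _ Fnx] [k _ Gky]]; exists (maxn n k) => //; split.
    - by move: x Fnx; exact/subsetPset/ndF/leq_maxl.
    - by move: y Gky; exact/subsetPset/ndG/leq_maxr.
  by move=> [n _ []/= ? ?]; split; exists n.
move=> k; have [? ?] := Foo k; have [? ?] := Goo k.
split; first exact: measurableX.
by rewrite product_measure1E// lte_mul_pinfty// ge0_fin_numE.
Qed.

Lemma sigma_finite_pushforward d1 d2 (T1 : measurableType d1)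
    (T2 : measurableType d2) (R : realType) (m : set T1 -> \bar R)
    (f : T1 -> T2) (g : T2 -> T1) :
  measurable_fun setT g -> cancel f g ->
  sigma_finite setT m -> sigma_finite setT (pushforward m f).
Proof.
move=> mg fK [F TF Foo].
exists (fun k => g @^-1` F k) => [|k]; first by rewrite -preimage_bigcup -TF.
have [mF Fk] := Foo k; split.
  by rewrite -[X in measurable X]setTI; exact: mg.
rewrite /pushforward -comp_preimage (_ : g \o f = id) ?preimage_id//.
exact: funext.
Qed.

Section cons_measure.
Context {d} {T : measurableType d} {R : realType} {n : nat}.
Local Open Scope ereal_scope.

Definition cons_pair (y : T * n.-tuple T) : n.+1.-tuple T :=
  [tuple of y.1 :: y.2].

Lemma measurable_cons_pair : measurable_fun [set: T * n.-tuple T] cons_pair.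
Proof. exact: measurable_cons. Qed.

Definition uncons_pair (t : n.+1.-tuple T) : T * n.-tuple T :=
  (thead t, [tuple of behead t]).

Lemma measurable_uncons_pair : measurable_fun [set: n.+1.-tuple T] uncons_pair.
Proof.
by apply/measurable_fun_pairP; split;
  [exact: measurable_tnth|exact: measurable_behead].
Qed.

Lemma cons_pairK : cancel cons_pair uncons_pair.
Proof.
by case=> a b; rewrite /uncons_pair /= theadE; congr pair; exact: val_inj.
Qed.

Variables (m1 : {sigma_finite_measure set T -> \bar R})
  (m2 : {sigma_finite_measure set (n.-tuple T) -> \bar R}).

Definition cons_measure : set (n.+1.-tuple T) -> \bar R :=
  pushforward (m1 \x m2) cons_pair.

HB.instance Definition _ := Measure.copy cons_measure
  (measure_function_pushforward__canonical__measure_function_Measure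
    (m1 \x m2) measurable_cons_pair).

Let cons_measure_sigma_finite : sigma_finite setT cons_measure.
Proof.
apply: (sigma_finite_pushforward measurable_uncons_pair cons_pairK).
exact: sigma_finite_product.
Qed.

HB.instance Definition _ :=
  Measure_isSigmaFinite.Build _ _ _ cons_measure cons_measure_sigma_finite.

End cons_measure.

Section tuple_measure.
Context {d} {T : measurableType d} {R : realType}.
Variable m : {sigma_finite_measure set T -> \bar R}.

(* The n-fold product measure m x ... x m; the library only has binary products.
   It is characterised on boxes by tuple_measure_box below. *)
Fixpoint tuple_measure (n : nat) :
    {sigma_finite_measure set (n.-tuple T) -> \bar R} :=
  match n with
  | 0 => dirac [tuple]
  | n'.+1 => cons_measure m (tuple_measure n')
  end.

Lemma measurable_tuple_box n (A : 'I_n -> set T) :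
  (forall i, measurable (A i)) ->
  measurable [set t : n.-tuple T | forall i, A i (tnth t i)].
Proof.
move=> mA; rewrite (_ : mkset _ =
    \bigcap_(i in [set: 'I_n]) ((fun t => tnth t i) @^-1` A i)); last first.
  by apply/seteqP; split=> t /= H i => [_|]; exact: H.
apply: fin_bigcap_measurable => // i _; rewrite -[X in measurable X]setTI.
exact: measurable_tnth.
Qed.

Lemma tuple_measure_box n (A : 'I_n -> set T) : (forall i, measurable (A i)) ->
  tuple_measure n [set t | forall i, A i (tnth t i)] = (\prod_i m (A i))%E.
Proof.
elim: n A => [|n IHn] A mA.
  by rewrite big_ord0 /= diracE mem_set// => -[].
rewrite big_ord_recl -IHn// -product_measure1E//; last first.
  by apply: (@measurable_tuple_box n (fun i => A (lift ord0 i))) => i;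
    exact: mA.
rewrite /= /cons_measure /pushforward; congr (product_measure1 _ _ _).
apply/seteqP; split => -[a b] /=.
- move=> H; split=> [|i]; first exact: (H ord0).
  by have := H (lift ord0 i); rewrite (tnth_nth a) (tnth_nth a).
- move=> [Aa Ab] i; case: (unliftP ord0 i) => [j|] -> //.
  by have := Ab j; rewrite !(tnth_nth a).
Qed.

End tuple_measure.

Definition lebesgue_tuple (R : realType) (n : nat) :
    {sigma_finite_measure set (n.-tuple (measurableTypeR R)) -> \bar R} :=
  tuple_measure (@lebesgue_measure R) n.

Definition unit_cube (R : realType) (d : nat) :
    set (d.-tuple (measurableTypeR R)) :=
  [set x | forall i, tnth x i \in `[0, 1]].

(* Also used for 0 < p < 1, where it is only a quasi-norm. *)
Definition cube_Lnorm (R : realType) (d : nat) (p : R)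
    (f : d.-tuple (measurableTypeR R) -> R[i]) : \bar R :=
  ((\int[lebesgue_tuple R d]_(x in @unit_cube R d)
      (Normc.normc (f x) `^ p)%:E) `^ p^-1)%E.

Lemma cube_LnormE (R : realType) (d : nat) (p : R)
    (f : d.-tuple (measurableTypeR R) -> R[i]) : p != 0 ->
  cube_Lnorm p f =
  'N[lebesgue_tuple R d]_p%:E
    [(EFin \o @Normc.normc R \o f) \_ (@unit_cube R d)]%E.
Proof.
move=> p0; rewrite /cube_Lnorm integral_mkcond unlock /=; congr (_ `^ _)%E.
apply: eq_integral => x _; rewrite !patchE; case: ifPn => _ /=.
  by case: (f x) => a b /=; rewrite ger0_norm ?sqrtr_ge0.
by rewrite normr0 powR0.
Qed.

(* e(theta) = exp (2 pi i theta), spelled out as the library has no complex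
   exponential. *)
Definition cexp2pi (R : realType) (theta : R) : R[i] :=
  (cos (2 * pi * theta) +i* sin (2 * pi * theta))%C.

Definition dotZR (R : realType) (d : nat) (n : 'rV[int]_d)
    (x : d.-tuple (measurableTypeR R)) : R :=
  \sum_(i < d) (n 0 i)%:~R * tnth x i.

Definition finitely_supported (R : realType) (d : nat) (Gamma : set 'rV[int]_d)
    (a : 'rV[int]_d -> R) : Prop :=
  finite_set [set n | Gamma n /\ a n != 0].

(* A family indexed by Gamma is a total function whose values outside Gamma are
   irrelevant. The sum is the intended one for finitely supported families
   only: the library sets it to 0 otherwise. *)
Definition exp_sum (R : realType) (d : nat) (Gamma : set 'rV[int]_d)
    (a : 'rV[int]_d -> R) (x : d.-tuple (measurableTypeR R)) : R[i] :=
  \sum_(n \in Gamma) ((a n)%:C)%C * cexp2pi (dotZR n x).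

Definition strict_majorant (R : realType) (d : nat) (Gamma : set 'rV[int]_d)
    (p : R) : Prop :=
  forall a A : 'rV[int]_d -> R,
    finitely_supported Gamma a -> finitely_supported Gamma A ->
    (forall n, Gamma n -> `|a n| <= A n) ->
    (cube_Lnorm p (exp_sum Gamma a) <= cube_Lnorm p (exp_sum Gamma A))%E.

Definition linearly_independent (K : fieldType) (V : vectType K) (S : set V) :
    Prop :=
  forall s : seq V, uniq s -> [set` s] `<=` S -> free s.

(* Linear independence is that of R^d, in which Z^d is embedded
   coordinatewise. *)
Definition affinely_independent (R : realType) (d : nat)
    (Gamma : set 'rV[int]_d) : Prop :=
  forall n0, Gamma n0 ->
    linearly_independent
      [set map_mx (fun z : int => z%:~R : R) (n - n0) | n in Gamma `\ n0].

(* Main.v *)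
(* Write |f|^p as |.|^(2 q) with q = p / 2.

   If Gamma is affinely independent, then for each frequency j there is a real
   vector v with (n - j).v = 1 for the other frequencies n. The integral over the
   cube is invariant under translation along t v, so it is also the mean over x
   and t of |a_j e(j.x) + e(t) b(x)|^p, and it suffices that the circle mean of
   |r + s e(t)|^p is nondecreasing in r. For r >= s this holds pointwise. For
   r < r' < s = 1 compare y = |1 + r' e(t)|^2 with x = |1 + r e(t)|^2: the convexity
   of exp and the single crossing of x and y give y^q - x^q >= q K^q (ln y - ln x)
   for a constant K, and ln x, ln y have mean 0 by Jensen's formula.

   If Gamma is not affinely independent, take an integer affine relation c whose
   support is minimal, and of minimal l^1 norm on this support; every relation on
   the support is then an integer multiple of c, and some c_n is odd. Let M be the
   sum of the positive c_n, pick n_0 with c_(n_0) < 0, put m = M - 2 and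
   l_0 = M + c_(n_0), and let f = e(n_0.x) (1 + g) with all coefficients of g equal
   to eps up to sign. In |1 + g|^(2 q) = sum_(k, l) C(q, k) C(q, l) g^k conj(g)^l,
   flipping the sign of one frequency with odd c_n affects only the mean of terms
   with k >= M and l >= l_0 or conversely. For m < q < m + 1 the lowest of these has
   the factor C(q, M) C(q, l_0) < 0, and |C(q, k) C(q, l)| is at most a multiple of
   |C(q, M) C(q, l_0)|, uniformly in q, for the others. Hence one small eps works
   for all q. *)
Require Import Defs.
From HB Require Import structures.
From mathcomp Require Import all_boot all_order all_algebra.
From mathcomp Require Import all_classical all_reals all_analysis.
From mathcomp Require Import measurable_realfun complex ring lra.

Set Implicit Arguments.
Unset Strict Implicit.
Unset Printing Implicit Defensive.

Import Order.TTheory GRing.Theory Num.Theory.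
Import numFieldNormedType.Exports.

Local Open Scope classical_set_scope.
Local Open Scope ring_scope.

(** * Integrals of periodic functions *)

(** Below r = s the modulus |r + s e(t)| is not monotone in r for fixed t, and a tangent inequality
    in the squared moduli would leave a first-order term to be estimated. Written in logarithms,
    that term has mean exactly 0.

    In the counterexample the coefficients are fixed before p, while C(q, m + 2) tends to 0 as q
    tends to m or to m + 1, so the gain has no positive lower bound over q. What helps is that every
    term changed by the sign flip has an index at least m + 2. Such terms can therefore be measured
    relative to the main one, and all bounds on binomial coefficients below are ratios for this
    reason. The index m + 2 is the first at which C(q, .) is negative for m < q < m + 1, whereas l_0
    <= m + 1 gives a positive factor; this fixes the interval of exponents. The order at which the
    binomial series is truncated may depend on q, because the truncation error only has to beat the
    gain for that same q. *)

Section periodic_line.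
Context {R : realType}.
Local Open Scope ereal_scope.
Local Notation mu := (@lebesgue_measure R).

Lemma lebesgue_measure_translation (w : R) (A : set (measurableTypeR R)) :
  measurable A ->
  mu A = pushforward mu (fun t : measurableTypeR R => (t + w)%R : measurableTypeR R) A.
Proof.
move=> mA.
have mf : measurable_fun setT
    (fun t : measurableTypeR R => (t + w)%R : measurableTypeR R).
  exact: measurable_funD.
pose nu := [the measure _ _ of
  measure_function_pushforward__canonical__measure_function_Measure mu mf].
apply: (@lebesgue_measure_unique R nu) => // _ [[a b] /= ab <-].
rewrite /nu /= /pushforward.
rewrite (_ : _ @^-1` _ = `](a - w)%R, (b - w)%R]%classic); last first.
  by apply/seteqP; split => x /=; rewrite !in_itv/= => /andP[? ?]; apply/andP; split; lra.
rewrite !lebesgue_measure_itv/= !lte_fin ltrD2r.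
by case: ifP => // _; rewrite -!EFinB; congr EFin; ring.
Qed.

Lemma ge0_integral_translation (w : R) (D : set (measurableTypeR R))
    (f : measurableTypeR R -> \bar R) :
  measurable D -> measurable_fun D f -> {in D, forall y, 0 <= f y} ->
  \int[mu]_(x in D) f x =
  \int[mu]_(x in (fun t : measurableTypeR R => (t + w)%R) @^-1` D) f (x + w)%R.
Proof.
move=> mD mf f0.
have mT : measurable_fun setT
    (fun t : measurableTypeR R => (t + w)%R : measurableTypeR R).
  exact: measurable_funD.
rewrite -(ge0_integral_pushforward mT) //.
apply: eq_measure_integral => A mA _; exact: lebesgue_measure_translation.
Qed.

Lemma periodic_int T (f : R -> T) : (forall t, f (t + 1)%R = f t) ->
  forall (z : int) t, f (t + z%:~R)%R = f t.
Proof.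
move=> fp; have fn (n : nat) t : f (t + n%:R)%R = f t.
  elim: n t => [|n IHn] t; first by rewrite addr0.
  by rewrite -natr1 addrA fp IHn.
case=> n t; first exact: fn.
by rewrite -(fn n.+1 (t + _)%R) NegzE mulrNz addrNK.
Qed.

(** Only the fractional part [v] of [w] matters. The window [v, 1 + v[ is cut at 1 and the piece
    beyond 1 is moved back by one period; half-open intervals keep the pieces disjoint. *)
Lemma ge0_integral_periodic (w : R) (f : measurableTypeR R -> \bar R) :
  measurable_fun setT f -> (forall x, 0 <= f x) ->
  (forall t, f (t + 1)%R = f t) ->
  \int[mu]_(t in `[0%R, 1%R]) f (t + w)%R = \int[mu]_(t in `[0%R, 1%R]) f t.
Proof.
move=> mf f0 fp.
have mS D c : measurable_fun D (fun t : measurableTypeR R => f (t + c)%R).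
  apply: (@measurable_funS _ _ _ _ setT) => //.
  by apply: measurableT_comp => //; exact: measurable_funD.
have mF D : measurable_fun D f by exact: (@measurable_funS _ _ _ _ setT).
rewrite -(integral_itv_bndo_bndc (mF _)) -(integral_itv_bndo_bndc (mS _ w)).
pose v := (w - (Num.floor w)%:~R)%R.
have v0 : (0 <= v)%R by rewrite subr_ge0 floor_le.
have v1 : (v < 1)%R.
  by have := floorD1_gt w; rewrite intrD /v; lra.
transitivity (\int[mu]_(t in `[0%R, 1%R[) f (t + v)%R).
  apply: eq_integral => t _.
  by rewrite -(periodic_int fp (Num.floor w) (t + v)%R) /v -addrA subrK.
have shiftE a b c : \int[mu]_(t in `[a, b[) f (t + c)%R
    = \int[mu]_(t in `[(a + c)%R, (b + c)%R[) f t.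
  rewrite [RHS](@ge0_integral_translation c)//.
  congr (integral _ _ _); apply/seteqP; split => x /=; rewrite !in_itv/=;
    by move=> /andP[? ?]; apply/andP; split; lra.
rewrite shiftE add0r.
have vv : (v <= 1 + v)%R by lra.
rewrite (@itv_bndbnd_setU _ _ (BLeft v) (BLeft 1%R) (BLeft (1 + v)%R))//=; last 2 first.
  by rewrite bnd_simp ltW.
  by rewrite bnd_simp; lra.
rewrite ge0_integral_setU//=; last 1 first.
  by apply/disj_setPS => x /=; rewrite !in_itv/= => -[/andP[? ?] /andP[? ?]]; lra.
have -> : \int[mu]_(t in `[1%R, (1 + v)%R[) f t = \int[mu]_(t in `[0%R, v[) f t.
  rewrite -[X in `[X, _[](add0r 1%R) (addrC 1%R v) -shiftE.
  by apply: eq_integral => t _; rewrite fp.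
rewrite [RHS](_ : _ = \int[mu]_(t in `[0%R, v[ `|` `[v, 1%R[) f t); last first.
  by rewrite -itv_bndbnd_setU// bnd_simp// ltW.
rewrite ge0_integral_setU//=; first by rewrite addeC.
by apply/disj_setPS => x /=; rewrite !in_itv/= => -[/andP[? ?] /andP[? ?]]; lra.
Qed.

End periodic_line.

(** * Tonelli and translation invariance on the unit cube *)

Section cube_integral.
Context {R : realType}.
Local Open Scope ereal_scope.
Local Notation mu := (@lebesgue_measure R).
Local Notation T := (measurableTypeR R).

Definition tshift d (v : 'I_d -> R) (x : d.-tuple T) : d.-tuple T :=
  [tuple (tnth x i + v i)%R | i < d].

Lemma tnth_tshift d (v : 'I_d -> R) x i : tnth (tshift v x) i = (tnth x i + v i)%R.
Proof. by rewrite tnth_mktuple. Qed.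

Lemma tshift_cons d (v : 'I_d.+1 -> R) t x :
  tshift v (cons_pair (t, x)) =
  cons_pair ((t + v ord0)%R, tshift (v \o lift ord0) x).
Proof.
apply: eq_from_tnth => i; rewrite tnth_tshift.
case: (unliftP ord0 i) => [j|] -> //=.
by rewrite /cons_pair/= !tnthS tnth_tshift.
Qed.

Lemma measurable_tshift d (v : 'I_d -> R) : measurable_fun setT (tshift v).
Proof.
apply/measurable_fun_tnthP => i; rewrite (_ : _ \o _ = fun x => (tnth x i + v i)%R).
  by apply: measurable_funD => //; exact: measurable_tnth.
by apply/funext => x /=; rewrite tnth_tshift.
Qed.

Lemma measurable_unit_cube d : measurable (@unit_cube R d).
Proof.
by apply: (@measurable_tuple_box _ T d (fun=> `[0%R, 1%R]%classic)) => i.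
Qed.

Lemma ge0_integral_cubeS d (f : d.+1.-tuple T -> \bar R) :
  measurable_fun setT f -> (forall x, 0 <= f x) ->
  \int[lebesgue_tuple R d.+1]_(x in @unit_cube R d.+1) f x =
  \int[mu]_(t in `[0%R, 1%R]) \int[lebesgue_tuple R d]_(x in @unit_cube R d)
     f (cons_pair (t, x)).
Proof.
move=> mf f0.
rewrite (_ : \int[lebesgue_tuple R d.+1]_(x in @unit_cube R d.+1) f x =
  \int[mu \x lebesgue_tuple R d]_(y in cons_pair @^-1` (@unit_cube R d.+1))
    (f \o cons_pair) y); last first.
  rewrite -(ge0_integral_pushforward measurable_cons_pair) //.
  - exact: measurable_unit_cube.
  - exact: measurable_funTS.
have -> : cons_pair @^-1` (@unit_cube R d.+1) = `[0%R, 1%R] `*` @unit_cube R d.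
  apply/seteqP; split => -[a b] /=.
    move=> H; split=> [|i]; first exact: (H ord0).
    by have := H (lift ord0 i); rewrite /cons_pair tnthS.
  move=> [a01 b01] i; case: (unliftP ord0 i) => [j|] -> //.
  by rewrite /cons_pair tnthS.
have mX : measurable (`[0%R, 1%R] `*` @unit_cube R d : set (T * d.-tuple T)).
  by apply: measurableX => //; exact: measurable_unit_cube.
rewrite integral_mkcond fubini_tonelli1/=; last 2 first.
- apply/(measurable_restrictT _ mX)/measurable_funTS.
  exact: (measurableT_comp mf measurable_cons_pair).
- by move=> x; rewrite patchE; case: ifP => // _; exact: f0.
rewrite [RHS]integral_mkcond; apply: eq_integral => t _.
rewrite patchE /fubini_F; case: ifPn => t01.
  rewrite [RHS]integral_mkcond; apply: eq_integral => x _; rewrite !patchE.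
  rewrite (_ : ((t, x) \in _) = (x \in @unit_cube R d))//.
  apply/idP/idP; rewrite !inE => //; first by case.
  by move=> ?; split => //; rewrite inE in t01.
rewrite integral0_eq// => x _; rewrite patchE ifF//.
by apply/negbTE; apply: contra t01; rewrite !inE => -[].
Qed.

Lemma measurable_slice d (f : d.+1.-tuple T -> \bar R) :
  measurable_fun setT f -> (forall x, 0 <= f x) ->
  measurable_fun setT (fun t : T => \int[lebesgue_tuple R d]_(x in @unit_cube R d)
     f (cons_pair (t, x))).
Proof.
move=> mf f0.
rewrite (_ : (fun t : T => _) = fubini_F (lebesgue_tuple R d)
   ((f \o cons_pair) \_ (setT `*` @unit_cube R d))); last first.
  apply/funext => t; rewrite /fubini_F [LHS]integral_mkcond; apply: eq_integral => x _.
  rewrite !patchE (_ : ((t, x) \in _) = (x \in @unit_cube R d))//.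
  by apply/idP/idP; rewrite !inE => //; case.
have mX : measurable (setT `*` @unit_cube R d : set (T * d.-tuple T)).
  by apply: measurableX => //; exact: measurable_unit_cube.
apply: measurable_fun_fubini_tonelli_F.
- apply/(measurable_restrictT _ mX)/measurable_funTS.
  exact: (measurableT_comp mf measurable_cons_pair).
- by move=> x; rewrite patchE; case: ifP => // _; exact: f0.
Qed.

Definition Zperiodic {d} {U : Type} (f : d.-tuple T -> U) :=
  forall (z : 'I_d -> int) x, f (tshift (fun i => (z i)%:~R%R) x) = f x.

Lemma ge0_integral_cube_shift d (v : 'I_d -> R) (f : d.-tuple T -> \bar R) :
  measurable_fun setT f -> (forall x, 0 <= f x) -> Zperiodic f ->
  \int[lebesgue_tuple R d]_(x in @unit_cube R d) f (tshift v x) =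
  \int[lebesgue_tuple R d]_(x in @unit_cube R d) f x.
Proof.
elim: d v f => [|d IHd] v f mf f0 pf.
  apply: eq_integral => x _; congr f; apply: eq_from_tnth => -[//].
have mslice t : measurable_fun setT (fun x : d.-tuple T => f (cons_pair (t, x))).
  apply: measurableT_comp => //.
  apply: (measurableT_comp measurable_cons_pair) => //.
rewrite !ge0_integral_cubeS//; last first.
  by apply: measurableT_comp => //; exact: measurable_tshift.
pose g (t : T) := \int[lebesgue_tuple R d]_(x in @unit_cube R d) f (cons_pair (t, x)).
transitivity (\int[mu]_(t in `[0%R, 1%R]) g (t + v ord0)%R).
  apply: eq_integral => t _.
  rewrite /g -(IHd (v \o lift ord0) (fun x => f (cons_pair ((t + v ord0)%R, x))) (mslice _))//.
    by apply: eq_integral => x _; congr f; exact: tshift_cons.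
  (* An integer period of the slice is extended by 0 in the first coordinate. *)
  move=> z x; rewrite -[RHS](pf (fun i => if unlift ord0 i is Some j then z j else 0%R)).
  rewrite tshift_cons unlift_none addr0; congr (f (cons_pair (_, _))).
  by congr (tshift _ _); apply/funext => i /=; rewrite liftK.
apply: ge0_integral_periodic.
- exact: measurable_slice.
- by move=> t; apply: integral_ge0 => x _; exact: f0.
- move=> t; apply: eq_integral => x _.
  rewrite -[RHS](pf (fun i => if unlift ord0 i is Some j then 0%R else 1%R)).
  rewrite tshift_cons unlift_none; congr (f (cons_pair (_, _))).
  by apply: eq_from_tnth => i; rewrite tnth_tshift /= liftK addr0.
Qed.

Lemma lebesgue_unit_cube d : lebesgue_tuple R d (@unit_cube R d) = 1.
Proof.
rewrite (@tuple_measure_box _ T R mu d (fun=> `[0%R, 1%R]%classic))//.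
by rewrite big1// => i _; rewrite /= lebesgue_measure_itv/= lte_fin ltr01 oppr0 adde0.
Qed.

Lemma ge0_integral_cube_swap d (f : T * d.-tuple T -> \bar R) :
  measurable_fun setT f -> (forall x, 0 <= f x) ->
  \int[mu]_(t in `[0%R, 1%R]) \int[lebesgue_tuple R d]_(x in @unit_cube R d) f (t, x) =
  \int[lebesgue_tuple R d]_(x in @unit_cube R d) \int[mu]_(t in `[0%R, 1%R]) f (t, x).
Proof.
move=> mf f0.
pose D := (`[0%R, 1%R] `*` @unit_cube R d : set (T * d.-tuple T)).
have mX : measurable D.
  by apply: measurableX => //; exact: measurable_unit_cube.
have inD t x : ((t, x) \in D) = (t \in `[0%R, 1%R]%classic) && (x \in @unit_cube R d).
  by apply/idP/andP; rewrite !inE.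
transitivity (\int[mu]_t \int[lebesgue_tuple R d]_x (f \_ D) (t, x)).
  rewrite integral_mkcond; apply: eq_integral => t _; rewrite patchE.
  case: ifPn => t01.
    rewrite integral_mkcond; apply: eq_integral => x _.
    by rewrite !patchE inD t01.
  by rewrite integral0_eq// => x _; rewrite patchE inD (negbTE t01).
rewrite fubini_tonelli; last 2 first.
- exact/(measurable_restrictT _ mX)/measurable_funTS.
- by move=> x; rewrite patchE; case: ifP.
rewrite [RHS]integral_mkcond; apply: eq_integral => x _; rewrite patchE.
case: ifPn => t01.
  rewrite [RHS]integral_mkcond; apply: eq_integral => t _.
  by rewrite !patchE inD t01 andbT.
by rewrite integral0_eq// => t _; rewrite patchE inD (negbTE t01) andbF.
Qed.

End cube_integral.

(** * Means of bounded measurable functions for a probability measure *)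

Section bounded_measurable.
Context {d} {T : measurableType d} {R : realType}.

(** On a set of measure 1 this implies integrability, and it is stable under the algebraic
    operations, so integrability conditions reduce to closure lemmas. *)
Definition bounded_measurable (f : T -> R) :=
  measurable_fun setT f /\ exists C, forall x, `|f x| <= C.

Lemma bounded_measurable_cst r : bounded_measurable (fun=> r).
Proof. by split; [exact: measurable_cst|exists `|r|]. Qed.

Lemma bounded_measurableD f g : bounded_measurable f -> bounded_measurable g ->
  bounded_measurable (fun x => f x + g x).
Proof.
move=> [mf [C fC]] [mg [D gD]]; split; first exact: measurable_funD.
by exists (C + D) => x; rewrite (le_trans (ler_normD _ _))// lerD.
Qed.

Lemma bounded_measurableM f g : bounded_measurable f -> bounded_measurable g ->
  bounded_measurable (fun x => f x * g x).
Proof.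
move=> [mf [C fC]] [mg [D gD]]; split; first exact: measurable_funM.
by exists (C * D) => x; rewrite normrM ler_pM.
Qed.

Lemma bounded_measurableN f : bounded_measurable f ->
  bounded_measurable (fun x => - f x).
Proof.
move=> [mf [C fC]]; split; first exact: measurable_funN.
by exists C => x; rewrite normrN.
Qed.

Lemma bounded_measurable_sum I (s : seq I) (P : pred I) (F : I -> T -> R) :
  (forall i, bounded_measurable (F i)) ->
  bounded_measurable (fun x => \sum_(i <- s | P i) F i x).
Proof.
move=> bF; elim: s => [|i s IHs].
  have -> : (fun x => \sum_(i <- [::] | P i) F i x) = (fun=> 0).
    by apply: funext => x; rewrite big_nil.
  exact: bounded_measurable_cst.
have -> : (fun x => \sum_(j <- i :: s | P j) F j x) =
    (fun x => (if P i then F i x else 0) + \sum_(j <- s | P j) F j x).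
  by apply: funext => x; rewrite big_cons; case: ifP => // _; rewrite add0r.
apply: bounded_measurableD => //.
by case: (P i) => //; exact: bounded_measurable_cst.
Qed.

Lemma bounded_measurable_powR (q : R) f : 0 <= q -> (forall x, 0 <= f x) ->
  bounded_measurable f -> bounded_measurable (fun x => f x `^ q).
Proof.
move=> q0 f0 [mf [C fC]]; split.
  by apply: (@measurableT_comp _ _ _ _ _ _ (@powR R ^~ q)) => //; exact: measurable_powR.
exists (C `^ q) => x; rewrite ger0_norm ?powR_ge0//.
have fxC : f x <= C by rewrite (le_trans (ler_norm _)).
by apply: ge0_ler_powR => //; rewrite nnegrE// (le_trans _ fxC).
Qed.

Variables (mu : {measure set T -> \bar R}) (D : set T).
Hypotheses (mD : measurable D) (muD : mu D = 1%E).
Local Notation mean f := (Rintegral mu D f).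

Lemma bounded_measurable_integrable f : bounded_measurable f ->
  mu.-integrable D (EFin \o f).
Proof.
move=> [mf [C fC]]; apply: measurable_bounded_integrable => //.
- by rewrite [X in (X < _)%E]muD ltry.
- exact: measurable_funTS.
- by exists C; split; [exact: num_real|move=> M CM x _ /=; exact/ltW/(le_lt_trans _ CM)].
Qed.
Local Notation bmi := bounded_measurable_integrable.

Lemma mean_cst (r : R) : mean (fun=> r) = r.
Proof. by rewrite Rintegral_cst// muD mulr1. Qed.

Lemma meanD f g : bounded_measurable f -> bounded_measurable g ->
  mean (fun x => f x + g x) = mean f + mean g.
Proof. by move=> bf bg; apply: RintegralD => //; exact: bmi. Qed.

Lemma meanB f g : bounded_measurable f -> bounded_measurable g ->
  mean (fun x => f x - g x) = mean f - mean g.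
Proof. by move=> bf bg; apply: RintegralB => //; exact: bmi. Qed.

Lemma meanZ c f : bounded_measurable f -> mean (fun x => c * f x) = c * mean f.
Proof. by move=> bf; apply: RintegralZl => //; exact: bmi. Qed.

Lemma mean_sum I (s : seq I) (P : pred I) (F : I -> T -> R) :
  (forall i, bounded_measurable (F i)) ->
  mean (fun x => \sum_(i <- s | P i) F i x) = \sum_(i <- s | P i) mean (F i).
Proof.
move=> bF; elim: s => [|i s IHs].
  rewrite big_nil -[RHS]mean_cst; apply: eq_Rintegral => x _; exact: big_nil.
rewrite big_cons -IHs; case: ifPn => Pi.
  rewrite -meanD//; last exact: bounded_measurable_sum.
  by apply: eq_Rintegral => x _; rewrite big_cons Pi.
by apply: eq_Rintegral => x _; rewrite big_cons (negbTE Pi).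
Qed.

Lemma le_mean f g : bounded_measurable f -> bounded_measurable g ->
  (forall x, f x <= g x) -> mean f <= mean g.
Proof. by move=> bf bg fg; apply: le_Rintegral => //; exact: bmi. Qed.

Lemma le_norm_mean f C : bounded_measurable f -> (forall x, `|f x| <= C) ->
  `|mean f| <= C.
Proof.
move=> bf fC; rewrite ler_norml -{1}(mean_cst (- C)) -{2}(mean_cst C).
by apply/andP; split; apply: le_mean => //; first [exact: bounded_measurable_cst
  |by move=> x; have := fC x; rewrite ler_norml => /andP[]].
Qed.

Lemma integral_mean f : bounded_measurable f ->
  (\int[mu]_(x in D) (f x)%:E)%E = (mean f)%:E.
Proof. by move=> bf; rewrite fineK//; exact/integrable_fin_num/bmi. Qed.

End bounded_measurable.

Section mean_shift.
Context {R : realType}.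
Local Notation T := (measurableTypeR R).

Lemma mean_periodic_shift (w : R) (f : T -> R) :
  bounded_measurable f -> (forall t, f (t + 1) = f t) ->
  \int[@lebesgue_measure R]_(t in `[0, 1]) f (t + w)
  = \int[@lebesgue_measure R]_(t in `[0, 1]) f t.
Proof.
move=> bf pf; have [mf [C fC]] := bf.
have I01 : @lebesgue_measure R `[0, 1] = 1%E.
  by rewrite lebesgue_measure_itv/= lte_fin ltr01 oppr0 adde0.
have bfw : bounded_measurable (fun t : T => f (t + w)).
  split; last by exists C.
  by apply: measurableT_comp => //; exact: measurable_funD.
have bC : bounded_measurable ((fun=> C) : T -> R) by exact: bounded_measurable_cst.
(* Adding the bound [C] makes the integrand nonnegative, as the Tonelli-type lemma requires. *)
apply: (addIr C); rewrite -[in LHS](mean_cst _ I01 C)// -[in RHS](mean_cst _ I01 C)//.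
rewrite -!meanD//; apply: EFin_inj; rewrite -!integral_mean//; last 2 first.
- exact: bounded_measurableD.
- exact: bounded_measurableD.
apply: (@ge0_integral_periodic R w (fun t => (f t + C)%:E)).
- by apply/measurable_EFinP; case: (bounded_measurableD bf bC).
- by move=> x; rewrite lee_fin; have := fC x; rewrite ler_norml => /andP[]; lra.
- by move=> t; rewrite pf.
Qed.

Lemma mean_cube_shift d (v : 'I_d -> R) (f : d.-tuple T -> R) :
  bounded_measurable f -> Zperiodic f ->
  \int[lebesgue_tuple R d]_(x in @unit_cube R d) f (tshift v x)
  = \int[lebesgue_tuple R d]_(x in @unit_cube R d) f x.
Proof.
move=> bf pf; have [mf [C fC]] := bf.
have I01 := @lebesgue_unit_cube R d.
have mD := @measurable_unit_cube R d.
have bfw : bounded_measurable (fun x => f (tshift v x)).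
  split; last by exists C.
  by apply: measurableT_comp => //; exact: measurable_tshift.
have bC : bounded_measurable ((fun=> C) : d.-tuple T -> R).
  exact: bounded_measurable_cst.
apply: (addIr C); rewrite -[in LHS](mean_cst mD I01 C)// -[in RHS](mean_cst mD I01 C)//.
rewrite -!meanD//; apply: EFin_inj; rewrite -!integral_mean//; last 2 first.
- exact: bounded_measurableD.
- exact: bounded_measurableD.
apply: (@ge0_integral_cube_shift R d v (fun t => (f t + C)%:E)).
- by apply/measurable_EFinP; case: (bounded_measurableD bf bC).
- by move=> x; rewrite lee_fin; have := fC x; rewrite ler_norml => /andP[]; lra.
- by move=> z t; rewrite pf.
Qed.

End mean_shift.

(** * Circle means *)

Section circle_means.
Context {R : realType}.
Local Notation T := (measurableTypeR R).
Local Notation mean f := (Rintegral (@lebesgue_measure R) `[0, 1]%classic f).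
Local Notation cosp t := (cos (2 * pi * t)).

Lemma lebesgue_01 : @lebesgue_measure R `[0, 1] = 1%E.
Proof. by rewrite lebesgue_measure_itv/= lte_fin ltr01 oppr0 adde0. Qed.

Lemma cos2pi_half (t : R) : cosp (t + 2^-1) = - cosp t.
Proof. by rewrite mulrDr -(cosDpi (2 * pi * t)); congr (cos (_ + _)); field. Qed.

Lemma cos2pi_int (t : R) (z : int) : cosp (t + z%:~R) = cosp t.
Proof.
apply: (@periodic_int R R (fun t => cosp t)) => u.
by rewrite mulrDr mulr1 -(cosD2pi (2 * pi * u)) -(mulr_natl pi).
Qed.

Lemma sin2pi_int (t : R) (z : int) : sin (2 * pi * (t + z%:~R)) = sin (2 * pi * t).
Proof.
apply: (@periodic_int R R (fun t => sin (2 * pi * t))) => u.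
by rewrite mulrDr mulr1 -(sinD2pi (2 * pi * u)) -(mulr_natl pi).
Qed.

(* [circ r s t] is |r + s e(t)|^2. *)
Definition circ (r s t : R) := r ^+ 2 + s ^+ 2 + 2 * r * s * cosp t.

Lemma circ_int r s t (z : int) : circ r s (t + z%:~R) = circ r s t.
Proof. by rewrite /circ cos2pi_int. Qed.

Lemma circ_ge_sqr r s t : 0 <= r -> 0 <= s -> (r - s) ^+ 2 <= circ r s t.
Proof.
move=> r0 s0; have c1 : 0 <= 1 + cosp t by have := cos_geN1 (2 * pi * t); lra.
by have := mulr_ge0 (mulr_ge0 r0 s0) c1; rewrite /circ; lra.
Qed.

Lemma circ_ge0 r s t : 0 <= r -> 0 <= s -> 0 <= circ r s t.
Proof. by move=> r0 s0; apply: le_trans (circ_ge_sqr t r0 s0); exact: sqr_ge0. Qed.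

Lemma circ_le_sqr r s t : 0 <= r -> 0 <= s -> circ r s t <= (r + s) ^+ 2.
Proof.
move=> r0 s0; have c1 : 0 <= 1 - cosp t by have := cos_le1 (2 * pi * t); lra.
by have := mulr_ge0 (mulr_ge0 r0 s0) c1; rewrite /circ; lra.
Qed.

Lemma measurable_cos2pi d (U : measurableType d) (f : U -> R) :
  measurable_fun setT f -> measurable_fun setT (fun t => cosp (f t)).
Proof.
move=> mf; apply: (@measurableT_comp _ _ _ _ _ _ (@cos R)).
  by apply: continuous_measurable_fun; exact: continuous_cos.
exact: measurable_funM.
Qed.

Lemma bounded_measurable_circ r s d (U : measurableType d) (f : U -> R) :
  0 <= r -> 0 <= s -> measurable_fun setT f ->
  bounded_measurable (fun t => circ r s (f t)).
Proof.
move=> r0 s0 mf; split.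
  apply: measurable_funD => //; apply: measurable_funM => //.
  exact: (measurable_cos2pi mf).
by exists ((r + s) ^+ 2) => x; rewrite ger0_norm ?circ_le_sqr// circ_ge0.
Qed.

(** With z = e(t), this is |1 + r z|^2 |1 - r z|^2 = |1 - r^2 z^2|^2; the shifts by 1/2 encode the
    minus signs. *)
Lemma circ_dup r t :
  circ 1 r t * circ 1 r (t + 2^-1) = circ 1 (r ^+ 2) (2 * t + 2^-1).
Proof.
rewrite /circ !cos2pi_half.
have -> : 2 * pi * (2 * t) = 2 * pi * t + 2 * pi * t by ring.
by rewrite cosD -!expr2 sin2cos2; ring.
Qed.

Lemma ln_circ_bound r t : 0 <= r < 1 ->
  `|ln (circ 1 r t)| <= ln 4 - 2 * ln (1 - r).
Proof.
move=> /andP[r0 r1].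
have l := @circ_ge_sqr 1 r t ler01 r0; have u := @circ_le_sqr 1 r t ler01 r0.
have p : 0 < 1 - r by lra.
have c0 : 0 < circ 1 r t by apply: lt_le_trans l; rewrite exprn_gt0.
have n1 : ln (1 - r) <= 0 by apply: ln_le0; lra.
have n4 : 0 <= ln (4 : R) by apply: ln_ge0; lra.
have : ln ((1 - r) ^+ 2) <= ln (circ 1 r t) by rewrite ler_ln ?posrE ?exprn_gt0.
rewrite lnXn// mulr2n.
have : ln (circ 1 r t) <= ln 4 by rewrite ler_ln ?posrE//; nra.
by rewrite ler_norml => *; apply/andP; split; lra.
Qed.

Lemma bounded_measurable_ln_circ r d (U : measurableType d) (f : U -> R) :
  0 <= r < 1 -> measurable_fun setT f ->
  bounded_measurable (fun t => ln (circ 1 r (f t))).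
Proof.
move=> r01 mf; have /andP[r0 _] := r01; split.
  apply: (@measurableT_comp _ _ _ _ _ _ (@ln R)); first exact: measurable_ln.
  by case: (bounded_measurable_circ ler01 r0 mf).
by exists (ln 4 - 2 * ln (1 - r)) => x; exact: ln_circ_bound.
Qed.

(** A shift of t by 1 / (2 n) preserves the mean and moves the argument by 1/2, so the two
    logarithms combine by [circ_dup]. Frequency [n] and phase [u] are arbitrary because duplication
    changes both, which makes the identity iterable. *)
Lemma mean_ln_circ_dup r n (u : R) : 0 <= r < 1 -> (0 < n)%N ->
  2 * mean (fun t : T => ln (circ 1 r (n%:R * t + u)))
  = mean (fun t : T => ln (circ 1 (r ^+ 2) ((2 * n)%:R * t + (2 * u + 2^-1)))).
Proof.
move=> r01 n0; have /andP[r0 r1] := r01.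
have nn0 : n%:R != 0 :> R by rewrite pnatr_eq0 -lt0n.
pose f (t : T) : R := ln (circ 1 r (n%:R * t + u)).
have bf : bounded_measurable f.
  apply: bounded_measurable_ln_circ => //.
  by apply: measurable_funD => //; exact: measurable_funM.
have pf t : f (t + 1) = f t.
  by rewrite /f -(circ_int 1 r (_ * t + u) n); congr (ln (circ _ _ _)); ring.
have fE t : f (t + (2 * n%:R)^-1) = ln (circ 1 r (n%:R * t + u + 2^-1)).
  by rewrite /f; congr (ln (circ _ _ _)); field.
transitivity (mean (fun t : T => f t) + mean (fun t : T => f (t + (2 * n%:R)^-1))).
  by rewrite (mean_periodic_shift _ bf pf) mulr_natl mulr2n.
rewrite -(meanD _ lebesgue_01)//; last first.
  rewrite (_ : (fun t => _) =
      fun t : T => ln (circ 1 r (n%:R * t + u + 2^-1))); last exact: funext.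
  apply: bounded_measurable_ln_circ => //.
  apply: measurable_funD => //; apply: measurable_funD => //; exact: measurable_funM.
apply: eq_Rintegral => t _; rewrite fE -lnM ?posrE ?circ_dup; last 2 first.
- by apply: lt_le_trans (circ_ge_sqr _ ler01 r0); rewrite exprn_gt0//; lra.
- by apply: lt_le_trans (circ_ge_sqr _ ler01 r0); rewrite exprn_gt0//; lra.
by congr (ln (circ _ _ _)); rewrite natrM; ring.
Qed.

(** Iterated duplication: replacing r by r^2 only improves the right-hand side, since 1 - r <= 1 -
    r^2. *)
Lemma mean_ln_circ_bound k r n (u : R) : 0 <= r < 1 -> (0 < n)%N ->
  2 ^+ k * `|mean (fun t : T => ln (circ 1 r (n%:R * t + u)))|
  <= ln 4 - 2 * ln (1 - r).
Proof.
elim: k r n u => [|k IHk] r n u r01 n0; have /andP[r0 r1] := r01.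
  rewrite expr0 mul1r; apply: le_norm_mean => //; first exact: lebesgue_01.
    apply: bounded_measurable_ln_circ => //.
    by apply: measurable_funD => //; exact: measurable_funM.
  by move=> t; exact: ln_circ_bound.
rewrite exprSr -mulrA -{2}(@ger0_norm R 2)// -normrM mean_ln_circ_dup//.
apply: (le_trans (IHk _ _ _ _ _)); first by apply/andP; split; nra.
  by rewrite muln_gt0.
rewrite lerB// ler_pM2l// ler_ln ?posrE; nra.
Qed.

(* Jensen's formula for 1 + r z: by duplication the integral I(r) satisfies
   2 I(r) = I(r^2), hence 2^k I(r) stays bounded. *)
Lemma mean_ln_circ r : 0 <= r < 1 -> mean (fun t : T => ln (circ 1 r t)) = 0.
Proof.
move=> r01; set I := mean _.
have bnd k : 2 ^+ k * `|I| <= ln 4 - 2 * ln (1 - r).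
  have := @mean_ln_circ_bound k r 1 0 r01 isT.
  by under eq_Rintegral do rewrite mul1r addr0.
apply/eqP; rewrite -normr_eq0; apply: contraT => I0.
have Ipos : 0 < `|I| by rewrite lt_def I0 normr_ge0.
have [k kP] : exists k : nat, (ln 4 - 2 * ln (1 - r)) / `|I| < k%:R.
  by exists (Num.bound ((ln 4 - 2 * ln (1 - r)) / `|I|)); rewrite archi_boundP// divr_ge0//
   (le_trans _ (bnd 0))// mulr_ge0.
have := bnd k; rewrite leNgt => /negP[].
move: kP; rewrite ltr_pdivrMr// => /lt_trans -> //.
by rewrite ltr_pM2r// -natrX ltr_nat ltn_expl.
Qed.

End circle_means.

(** * Monotonicity of the circle means in the radius *)

Section circle_monotone.
Context {R : realType}.
Local Notation T := (measurableTypeR R).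
Local Notation mean f := (Rintegral (@lebesgue_measure R) `[0, 1]%classic f).

Let mT : measurable_fun setT (fun t : T => t). Proof. exact: measurable_id. Qed.

Lemma bounded_measurable_circ_powR (q r s : R) : 0 <= q -> 0 <= r -> 0 <= s ->
  bounded_measurable (fun t : T => circ r s t `^ q).
Proof.
move=> q0 r0 s0; apply: bounded_measurable_powR => //.
  by move=> t; exact: circ_ge0.
exact: bounded_measurable_circ.
Qed.

Lemma ler_powR_base (q x y : R) : 0 <= q -> 0 <= x -> x <= y -> x `^ q <= y `^ q.
Proof.
by move=> q0 x0 xy; apply: ge0_ler_powR; rewrite ?nnegrE// (le_trans x0).
Qed.

(* With [L := ln (y / x)], the convexity of exp gives y^q >= x^q (1 + q L),
   and x^q L >= K^q L because x - K and L have the same sign. *)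
Lemma powR_ge_tangent (q x y K : R) : 0 < q -> 0 < x -> 0 < y -> 0 < K ->
  (x <= y -> K <= x) -> (y <= x -> x <= K) ->
  x `^ q + q * K `^ q * (ln y - ln x) <= y `^ q.
Proof.
move=> q0 x0 y0 K0 Kx xK.
have xq0 : 0 < x `^ q by exact: powR_gt0.
have H : x `^ q * (1 + q * (ln y - ln x)) <= y `^ q.
  have -> : y `^ q = x `^ q * expR (q * (ln y - ln x)).
    by rewrite /powR !gt_eqF// -expRD; congr expR; ring.
  by rewrite ler_pM2l//; exact: expR_ge1Dx.
apply: le_trans H; rewrite [x `^ q * (1 + _)]mulrDr mulr1 lerD2l.
rewrite [leRHS]mulrCA -mulrA ler_pM2l//.
have [xy|/ltW yx] := leP x y.
  rewrite ler_wpM2r// ?subr_ge0 ?ler_ln//.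
  by apply: ler_powR_base; [exact: ltW..|exact: Kx].
rewrite ler_wnM2r// ?subr_le0 ?ler_ln//.
by apply: ler_powR_base; [exact: ltW..|exact: xK].
Qed.

Lemma mean_circ_lt1 (q r s : R) : 0 < q -> 0 <= r -> r <= s -> s < 1 ->
  mean (fun t : T => circ 1 r t `^ q) <= mean (fun t : T => circ 1 s t `^ q).
Proof.
move=> q0 r0; rewrite le_eqVlt => /predU1P[->//|rs] s1.
have s0 := ltW (le_lt_trans r0 rs); have r1 := lt_trans rs s1.
have r01 : 0 <= r < 1 by rewrite r0. have s01 : 0 <= s < 1 by rewrite s0.
(* the common value of the two circ at the crossing point 2 cos = - (r + s) *)
pose K := 1 - r * s.
have K0 : 0 < K by rewrite /K; nra.
have pos u t : 0 <= u < 1 -> 0 < circ 1 u t.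
  move=> /andP[u0 u1]; apply: lt_le_trans (circ_ge_sqr t ler01 u0).
  by rewrite exprn_gt0//; lra.
have bln u : 0 <= u < 1 -> bounded_measurable (fun t : T => ln (circ 1 u t)).
  by move=> u01; exact: bounded_measurable_ln_circ.
have bpow u : 0 <= u -> bounded_measurable (fun t : T => circ 1 u t `^ q).
  by move=> u0; apply: bounded_measurable_circ_powR => //; exact: ltW.
have bB : bounded_measurable (fun t : T => ln (circ 1 s t) - ln (circ 1 r t)).
  by apply: bounded_measurableD; [|apply: bounded_measurableN]; exact: bln.
have bZ : bounded_measurable (fun t : T => q * K `^ q * (ln (circ 1 s t) - ln (circ 1 r t))).
  by apply: bounded_measurableM => //; exact: bounded_measurable_cst.
have <- : mean (fun t : T => circ 1 r t `^ q +
    q * K `^ q * (ln (circ 1 s t) - ln (circ 1 r t)))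
    = mean (fun t : T => circ 1 r t `^ q).
  rewrite (meanD _ lebesgue_01) ?(meanZ _ lebesgue_01) ?(meanB _ lebesgue_01)//;
    do ?[exact: bln|exact: bpow].
  by rewrite !mean_ln_circ// subr0 mulr0 addr0.
apply: (le_mean _ lebesgue_01) => //; do ?[exact: bpow].
  by apply: bounded_measurableD => //; exact: bpow.
move=> t; apply: powR_ge_tangent => //; do ?[exact: pos].
(* With c = r + s + 2 cos, the difference of the two [circ] is (s - r) c and [circ 1 r t - K] is r
   c, so they have the same sign. *)
- rewrite /circ /K => h.
  have : 0 <= (s - r) * (r + s + 2 * cos (2 * pi * t)) by lra.
  rewrite pmulr_rge0 ?subr_gt0// => /(mulr_ge0 r0); lra.
- rewrite /circ /K => h.
  have : (s - r) * (r + s + 2 * cos (2 * pi * t)) <= 0 by lra.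
  rewrite pmulr_rle0 ?subr_gt0// => /(mulr_ge0_le0 r0); lra.
Qed.

(** The difference [circ 1 1 t - circ 1 s t] equals 2 (1 - s) (1 + cos) - (1 - s)^2. *)
Lemma circ_near1 (s t : R) : 0 <= s -> s <= 1 ->
  circ 1 s t <= circ 1 1 t + (1 - s) ^+ 2.
Proof.
move=> s0 s1; rewrite /circ; set c := cos _.
have c1 : 0 <= 1 + c by have := cos_geN1 (2 * pi * t); rewrite /c; lra.
have := mulr_ge0 (_ : 0 <= 1 - s) c1; rewrite subr_ge0 => /(_ s1); lra.
Qed.

(** The additive error a^2 is absorbed by the factor 1 - a when y >= a; otherwise everything is
    below a. A disjunction, unlike a sum, passes through the power q even for q > 1, where powers
    are not subadditive. *)
Lemma scaled_le_or (a x y : R) : 0 < a -> a <= 1 -> x <= y + a ^+ 2 ->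
  (1 - a) * x <= y \/ (1 - a) * x <= a.
Proof.
move=> a0 a1; rewrite -subr_ge0 in a1; move=> /(ler_wpM2l a1) u.
have a3 := exprn_ge0 3 (ltW a0).
have [c1|/ltW c1] := leP a y; [left|right].
  by have := ler_wpM2l (ltW a0) c1; lra.
by have := ler_wpM2l a1 c1; lra.
Qed.

(* ln (circ 1 s) is unbounded for s = 1, so s tends to 1 instead: for s = 1 - a,
   the value s circ 1 s t is at most circ 1 1 t or at most a. *)
Lemma mean_circ_le1 (q r : R) : 0 < q -> 0 <= r -> r < 1 ->
  mean (fun t : T => circ 1 r t `^ q) <= mean (fun t : T => circ 1 1 t `^ q).
Proof.
move=> q0 r0 r1.
set A := mean _; set B := mean _.
have bpow u : 0 <= u -> bounded_measurable (fun t : T => circ 1 u t `^ q).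
  by move=> u0; apply: bounded_measurable_circ_powR => //; exact: ltW.
have key a : 0 < a -> a < 1 - r -> (1 - a) `^ q * A <= B + a `^ q.
  move=> a0 a1.
  pose s := 1 - a.
  have [s0 rs s1] : [/\ 0 <= s, r <= s & s < 1] by rewrite /s; split; lra.
  have AS := mean_circ_lt1 q0 r0 rs s1.
  apply: le_trans (_ : (1 - a) `^ q * mean (fun t : T => circ 1 s t `^ q) <= _).
    by rewrite ler_wpM2l// powR_ge0.
  have bs := bpow _ s0; have b1 := bpow _ (ler01 : 0 <= 1 :> R).
  have ba : bounded_measurable ((fun=> a `^ q) : T -> R) by exact: bounded_measurable_cst.
  rewrite -(meanZ _ lebesgue_01 _ bs)// -[a `^ q](mean_cst _ lebesgue_01)//.
  rewrite -(meanD _ lebesgue_01 b1 ba); last by [].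
  apply: (le_mean _ lebesgue_01); first by [].
  - by apply: bounded_measurableM => //; exact: bounded_measurable_cst.
  - exact: bounded_measurableD.
  move=> t; rewrite -powRM//; last exact: circ_ge0.
  have le2 : s * circ 1 s t <= circ 1 1 t \/ s * circ 1 s t <= a.
    apply: scaled_le_or => //; first by apply: ltW (lt_le_trans a1 _); rewrite gerBl.
    by have := circ_near1 t s0 (ltW s1); rewrite {2}/s opprB addrCA subrr addr0.
  case: le2 => h.
    rewrite -[leLHS]addr0 lerD ?powR_ge0//.
    by apply: ler_powR_base => //; [exact: ltW|rewrite mulr_ge0 ?circ_ge0].
  rewrite -[leLHS]add0r lerD ?powR_ge0//.
  by apply: ler_powR_base => //; [exact: ltW|rewrite mulr_ge0 ?circ_ge0].
have A0 : 0 <= A by apply: Rintegral_ge0 => t _; exact: powR_ge0.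
rewrite leNgt; apply/negP => BA; have D0 : 0 < A - B by rewrite subr_gt0.
(* As N > q, Bernoulli's inequality gives (1 - a)^q >= (1 - a)^N >= 1 - N a. *)
pose N := (Num.bound q).+1.
(* The three bounds ensure r < 1 - a, a^q <= (A - B) / 2 and N a A < (A - B) / 2; the [+ 1] in the
   last denominator keeps it positive and makes this inequality strict. *)
pose a := Num.min ((1 - r) / 2)
  (Num.min (((A - B) / 2) `^ q^-1) ((A - B) / (2 * (N%:R * A + 1)))).
have NA : 0 < N%:R * A + 1 by apply: ltr_wpDl => //; exact: mulr_ge0.
have a0 : 0 < a.
  by rewrite !lt_min !divr_gt0 ?powR_gt0 ?divr_gt0 ?mulr_gt0//; lra.
have a1 : a <= (1 - r) / 2 by rewrite ge_min lexx.
have a2 : a <= ((A - B) / 2) `^ q^-1 by rewrite !ge_min lexx orbT.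
have a3 : a <= (A - B) / (2 * (N%:R * A + 1)) by rewrite !ge_min lexx !orbT.
have ar : a < 1 - r by lra.
have := key _ a0 ar; rewrite leNgt => /negP; apply.
have aq : a `^ q <= (A - B) / 2.
  have -> : (A - B) / 2 = (((A - B) / 2) `^ q^-1) `^ q.
    by rewrite -powRrM mulVf ?gt_eqF// powRr1 ?divr_ge0// ltW.
  by apply: ler_powR_base => //; exact: ltW.
have aN : 1 - N%:R * a <= (1 - a) `^ q.
  apply: (@le_trans _ _ ((1 - a) `^ N%:R)); last first.
    apply: ger_powR; first by apply/andP; split; lra.
    by rewrite -natr1 ltW// ltr_wpDr// archi_boundP// ltW.
  rewrite powR_mulrn; last by lra.
  elim: (N) => [|n IHn]; first by rewrite expr0 mul0r subr0.
  rewrite exprS -natr1; have a11 : 0 <= 1 - a by lra.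
  have := ler_wpM2l a11 IHn; have := mulr_ge0 (ler0n R n) (sqr_ge0 a); lra.
have a4 : a * (N%:R * A + 1) <= (A - B) / 2.
  by move: a3; rewrite -ler_pdivlMr// invfM mulrA.
have := ler_wpM2r A0 aN; nra.
Qed.

Lemma circ_le (r r' s t : R) : 0 <= s -> s <= r -> r <= r' ->
  circ r s t <= circ r' s t.
Proof.
move=> s0 sr rr; have := cos_geN1 (2 * pi * t); rewrite -subr_ge0 opprK => c.
have := mulr_ge0 (mulr_ge0 s0 c) (_ : 0 <= r' - r).
rewrite subr_ge0 => /(_ rr); rewrite /circ; nra.
Qed.

Lemma mean_circ_mono (q r r' s : R) : 0 < q -> 0 <= r -> r <= r' -> 0 <= s ->
  mean (fun t : T => circ r s t `^ q) <= mean (fun t : T => circ r' s t `^ q).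
Proof.
move=> q0 r0 rr s0; have r'0 := le_trans r0 rr; have q0' := ltW q0.
have large u u' : s <= u -> u <= u' ->
    mean (fun t : T => circ u s t `^ q) <= mean (fun t : T => circ u' s t `^ q).
  move=> su uu'; have u0 := le_trans s0 su; have u'0 := le_trans u0 uu'.
  apply: (le_mean _ lebesgue_01) => //; do ?[exact: bounded_measurable_circ_powR].
  by move=> t; apply: ler_powR_base => //; [exact: circ_ge0|exact: circ_le].
have scale u : 0 < s -> 0 <= u -> mean (fun t : T => circ u s t `^ q) =
    (s ^+ 2) `^ q * mean (fun t : T => circ 1 (u / s) t `^ q).
  move=> s1 u0; have us : 0 <= u / s by exact: divr_ge0.
  rewrite -(meanZ _ lebesgue_01)//; last exact: bounded_measurable_circ_powR.
  apply: eq_Rintegral => t _; rewrite -powRM ?sqr_ge0 ?circ_ge0//.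
  by congr (_ `^ q); rewrite /circ; field; rewrite gt_eqF.
have [sr|rs] := leP s r; first exact: large.
have s1 : 0 < s by exact: le_lt_trans rs.
have small u u' : 0 <= u -> u <= u' -> u' < s ->
    mean (fun t : T => circ u s t `^ q) <= mean (fun t : T => circ u' s t `^ q).
  move=> u0 uu' u's; have u'0 := le_trans u0 uu'.
  rewrite (scale u s1 u0) (scale u' s1 u'0).
  apply: ler_wpM2l; first exact: powR_ge0.
  apply: mean_circ_lt1 => //; first exact: divr_ge0.
    by rewrite ler_pM2r ?invr_gt0.
  by rewrite ltr_pdivrMr// mul1r.
have [sr'|r's] := leP s r'; last exact: small.
(* When r < s <= r', the radius s serves as an intermediate point. *)
apply: (@le_trans _ _ (mean (fun t : T => circ s s t `^ q))); last exact: large.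
rewrite (scale r s1 r0) (scale s s1 s0).
apply: ler_wpM2l; first exact: powR_ge0.
rewrite divff; last by rewrite gt_eqF.
apply: mean_circ_le1 => //; first exact: divr_ge0.
by rewrite ltr_pdivrMr// mul1r.
Qed.

End circle_monotone.

(** * Affinely independent frequencies *)

Section trigonometric_sums.
Context {R : realType} {d : nat}.
Local Notation T := (d.-tuple (measurableTypeR R)).
Local Notation cube := (@unit_cube R d).
Local Notation mean f := (Rintegral (lebesgue_tuple R d) cube f).
Implicit Types (s : seq 'rV[int]_d) (a : 'rV[int]_d -> R) (n : 'rV[int]_d).

Definition dotv n (v : 'I_d -> R) : R := \sum_(i < d) (n 0 i)%:~R * v i.

Lemma dotZR_shift n v (x : T) : dotZR n (tshift v x) = dotZR n x + dotv n v.
Proof.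
rewrite /dotZR /dotv -big_split/=; apply: eq_bigr => i _.
by rewrite tnth_tshift mulrDr.
Qed.

Lemma dotvD m n v : dotv (m + n) v = dotv m v + dotv n v.
Proof.
by rewrite /dotv -big_split/=; apply: eq_bigr => i _; rewrite mxE intrD mulrDl.
Qed.

Lemma dotvB m n v : dotv (m - n) v = dotv m v - dotv n v.
Proof. by apply: (addIr (dotv n v)); rewrite -dotvD !subrK. Qed.

Lemma dotvZ n (c : R) v : dotv n (fun i => c * v i) = c * dotv n v.
Proof. by rewrite /dotv mulr_sumr; apply: eq_bigr => i _; rewrite mulrCA. Qed.

Lemma measurable_dotZR n : measurable_fun setT (@dotZR R d n).
Proof.
rewrite (_ : @dotZR R d n = fun x => \sum_(i < d) (n 0 i)%:~R * tnth x i)//.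
apply: measurable_sum => i; apply: measurable_funM => //.
exact: measurable_tnth.
Qed.

Definition tcos s a (x : T) : R := \sum_(n <- s) a n * cos (2 * pi * dotZR n x).
Definition tsin s a (x : T) : R := \sum_(n <- s) a n * sin (2 * pi * dotZR n x).
(** Squared modulus of the exponential sum; its power q = p / 2 is the integrand of the p-th power
    of the norm. *)
Definition tsqr s a (x : T) : R := tcos s a x ^+ 2 + tsin s a x ^+ 2.

Lemma tsqr_ge0 s a x : 0 <= tsqr s a x.
Proof. by rewrite addr_ge0 ?sqr_ge0. Qed.

Lemma bounded_measurable_cosZ n :
  bounded_measurable (fun x : T => cos (2 * pi * dotZR n x) : R).
Proof.
split; first by apply: measurable_cos2pi; exact: measurable_dotZR.
by exists 1 => x; rewrite ler_norml cos_geN1 cos_le1.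
Qed.

Lemma bounded_measurable_sinZ n :
  bounded_measurable (fun x : T => sin (2 * pi * dotZR n x) : R).
Proof.
split; last by exists 1 => x; rewrite ler_norml sin_geN1 sin_le1.
apply: (@measurableT_comp _ _ _ _ _ _ (@sin R)).
  by apply: continuous_measurable_fun; exact: continuous_sin.
by apply: measurable_funM => //; exact: measurable_dotZR.
Qed.

Lemma bounded_measurable_tcos s a : bounded_measurable (tcos s a).
Proof.
apply: bounded_measurable_sum => n; apply: bounded_measurableM.
  exact: bounded_measurable_cst.
exact: bounded_measurable_cosZ.
Qed.

Lemma bounded_measurable_tsin s a : bounded_measurable (tsin s a).
Proof.
apply: bounded_measurable_sum => n; apply: bounded_measurableM.
  exact: bounded_measurable_cst.
exact: bounded_measurable_sinZ.
Qed.

Lemma bounded_measurable_tsqr s a : bounded_measurable (tsqr s a).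
Proof.
have bc := bounded_measurable_tcos s a; have bs := bounded_measurable_tsin s a.
have := bounded_measurableD (bounded_measurableM bc bc) (bounded_measurableM bs bs).
by rewrite (_ : (fun x => _) = tsqr s a).
Qed.

Lemma bounded_measurable_tsqr_powR q s a : 0 <= q ->
  bounded_measurable (fun x => tsqr s a x `^ q).
Proof.
move=> q0; apply: bounded_measurable_powR => //; first exact: tsqr_ge0.
exact: bounded_measurable_tsqr.
Qed.

Lemma dotv_int n (z : 'I_d -> int) :
  dotv n (fun i => (z i)%:~R) = (\sum_i n 0 i * z i)%:~R.
Proof. by rewrite /dotv rmorph_sum/=; apply: eq_bigr => i _; rewrite intrM. Qed.

Lemma Zperiodic_tsqr s a : Zperiodic (tsqr s a).
Proof.
move=> z x; rewrite /tsqr /tcos /tsin; congr (_ ^+ 2 + _ ^+ 2).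
  by apply: eq_bigr => n _; rewrite dotZR_shift dotv_int cos2pi_int.
by apply: eq_bigr => n _; rewrite dotZR_shift dotv_int sin2pi_int.
Qed.

Lemma exp_sum_seqE Gamma a s x : uniq s -> [set` s] `<=` Gamma ->
  (forall n, Gamma n -> n \notin s -> a n = 0) ->
  exp_sum Gamma a x = (tcos s a x +i* tsin s a x)%C.
Proof.
move=> us sG a0; rewrite /exp_sum -(fsbig_widen [set` s] Gamma)//; last first.
  by move=> n [Gn /= /negP ns]; rewrite a0// mul0r.
rewrite -fsbig_seq// /tcos /tsin; elim: s {us sG a0} => [|n s IHs].
  by rewrite !big_nil.
rewrite !big_cons IHs /cexp2pi /=; apply/eqP; rewrite eq_complex /=.
by rewrite !mul0r subr0 addr0 !eqxx.
Qed.

Lemma cube_Lnorm_exp_sum (p : R) Gamma a s : 0 < p ->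
  uniq s -> [set` s] `<=` Gamma ->
  (forall n, Gamma n -> n \notin s -> a n = 0) ->
  cube_Lnorm p (exp_sum Gamma a)
  = (mean (fun x => tsqr s a x `^ (p / 2)) `^ p^-1)%:E.
Proof.
move=> p0 us sG a0; rewrite /cube_Lnorm -poweR_EFin; congr (_ `^ _)%E.
rewrite -integral_mean; last 3 first.
- exact: measurable_unit_cube.
- exact: lebesgue_unit_cube.
- by apply: bounded_measurable_tsqr_powR; rewrite divr_ge0// ltW.
apply: eq_integral => x _; congr EFin.
rewrite (exp_sum_seqE x us sG a0) /Normc.normc -/(tsqr s a x).
by rewrite -powR12_sqrt ?tsqr_ge0// -powRrM mulrC.
Qed.

Lemma mean_tsqr_ge0 q s a : 0 <= mean (fun x => tsqr s a x `^ q).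
Proof. by apply: Rintegral_ge0 => x _; exact: powR_ge0. Qed.

End trigonometric_sums.

Section majorant.
Context {R : realType} {d : nat}.
Local Notation T := (d.-tuple (measurableTypeR R)).
Local Notation cube := (@unit_cube R d).
Local Notation mean f := (Rintegral (lebesgue_tuple R d) cube f).
Local Notation mean1 f := (Rintegral (@lebesgue_measure R) `[0, 1]%classic f).
Implicit Types (s : seq 'rV[int]_d) (a : 'rV[int]_d -> R) (n : 'rV[int]_d).

Lemma polar_form (x y : R) : exists2 r, 0 <= r &
  exists u, x = r * cos (2 * pi * u) /\ y = r * sin (2 * pi * u).
Proof.
exists (Num.sqrt (x ^+ 2 + y ^+ 2)); first exact: sqrtr_ge0.
have p0 : 2 * pi != 0 :> R by rewrite mulf_neq0// gt_eqF// pi_gt0.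
suff [u [xu yu]] : exists u, x = Num.sqrt (x ^+ 2 + y ^+ 2) * cos u /\
    y = Num.sqrt (x ^+ 2 + y ^+ 2) * sin u.
  by exists (u / (2 * pi)); rewrite mulrCA divff// mulr1.
have h0 : 0 <= x ^+ 2 + y ^+ 2 by rewrite addr_ge0 ?sqr_ge0.
set r := Num.sqrt _; have r2 : r ^+ 2 = x ^+ 2 + y ^+ 2 by rewrite sqr_sqrtr.
have [r0|r0] := eqVneq r 0.
  exists 0; move: r2; rewrite r0 expr0n/= => /esym/eqP.
  by rewrite paddr_eq0 ?sqr_ge0// !sqrf_eq0 => /andP[/eqP-> /eqP->]; rewrite !mul0r.
have rp : 0 < r by rewrite lt_def r0 sqrtr_ge0.
have xr : -1 <= x / r <= 1.
  rewrite ler_pdivlMr// ler_pdivrMr// mulN1r mul1r -ler_norml.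
  by rewrite -sqrtr_sqr ler_wsqrtr// lerDl sqr_ge0.
have cosa : cos (acos (x / r)) = x / r by rewrite acosK// in_itv/=.
have sina : (r * sin (acos (x / r))) ^+ 2 = y ^+ 2.
  rewrite exprMn sin2cos2 cosa expr_div_n mulrBr mulr1 mulrCA divff ?sqrf_eq0//.
  by rewrite r2; ring.
move/eqP: sina; rewrite eqf_sqr => /orP[]/eqP sina.
  by exists (acos (x / r)); rewrite cosa sina mulrCA divff// mulr1.
exists (- acos (x / r)); rewrite cosN sinN cosa mulrN sina opprK mulrCA divff//.
by rewrite mulr1.
Qed.

Definition csqr (x y : R) := x ^+ 2 + y ^+ 2.

(* The integrand on the left is |c e(w) + e(t) (x + i y)|^(2 q). *)
Lemma mean1_csqr (q : R) (x y : R) : 0 <= q -> exists2 r, 0 <= r &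
  forall c w : R, mean1 (fun t : measurableTypeR R =>
    csqr (c * cos (2 * pi * w) + (x * cos (2 * pi * t) - y * sin (2 * pi * t)))
         (c * sin (2 * pi * w) + (x * sin (2 * pi * t) + y * cos (2 * pi * t))) `^ q)
  = mean1 (fun t : measurableTypeR R => circ `|c| r t `^ q).
Proof.
move=> q0; have [r r0 [u [-> ->]]] := polar_form x y; exists r; first exact: r0.
(* A negative [c] is turned into [|c|] by a half turn [b]. *)
move=> c w; have [b cb] : exists b, forall z : R, c * cos z = `|c| * cos (z + 2 * pi * b) /\
                             c * sin z = `|c| * sin (z + 2 * pi * b).
  have [c0|c0] := leP 0 c.
    by exists 0 => z; rewrite ger0_norm// mulr0 addr0.
  exists 2^-1 => z; rewrite ltr0_norm//.
  have -> : 2 * pi * 2^-1 = pi :> R by field.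
  by rewrite cosDpi sinDpi !mulrNN.
(* Only the relative phase of the two summands matters, and the mean over t absorbs it. *)
rewrite -(@mean_periodic_shift R (u - w - b) (fun t => circ `|c| r t `^ q)); last 2 first.
- exact: bounded_measurable_circ_powR.
- by move=> t; rewrite (circ_int _ _ _ 1).
apply: eq_Rintegral => t _; congr (_ `^ q).
have [-> ->] := cb (2 * pi * w).
have -> : 2 * pi * w + 2 * pi * b = 2 * pi * (w + b) by ring.
rewrite /circ /csqr.
have -> : t + (u - w - b) = (t + u) - (w + b) by ring.
rewrite mulrBr cosB (mulrDr _ t u) cosD sinD.
have := cos2Dsin2 (2 * pi * (w + b)); have := cos2Dsin2 (2 * pi * t).
have := cos2Dsin2 (2 * pi * u).
set A := cos (2 * pi * (w + b)); set B := sin (2 * pi * (w + b)).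
set C := cos (2 * pi * t); set D := sin (2 * pi * t).
set E := cos (2 * pi * u); set F := sin (2 * pi * u).
move=> EF CD AB.
have -> : `|c| ^+ 2 = `|c| ^+ 2 * (A ^+ 2 + B ^+ 2) by rewrite AB mulr1.
have -> : r ^+ 2 = r ^+ 2 * (E ^+ 2 + F ^+ 2) * (C ^+ 2 + D ^+ 2).
  by rewrite EF CD !mulr1.
ring.
Qed.

(** Translation along t v turns every term by the phase [c] of the frequency j, which the modulus
    ignores, and the terms n != j by a further e(t). *)
Lemma tsqr_shift s a (v : 'I_d -> R) j (t : R) (x : T) : uniq s -> j \in s ->
  (forall n, n \in s -> n != j -> dotv n v = dotv j v + 1) ->
  let X := \sum_(n <- rem j s) a n * cos (2 * pi * dotZR n x) in
  let Y := \sum_(n <- rem j s) a n * sin (2 * pi * dotZR n x) in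
  tsqr s a (tshift (fun i => t * v i) x) =
  csqr (a j * cos (2 * pi * dotZR j x) + (X * cos (2 * pi * t) - Y * sin (2 * pi * t)))
       (a j * sin (2 * pi * dotZR j x) + (X * sin (2 * pi * t) + Y * cos (2 * pi * t))).
Proof.
move=> us js jv X Y; rewrite /tsqr /tcos /tsin.
pose c := 2 * pi * (t * dotv j v).
have rot (P Q : R) : csqr (P * cos c - Q * sin c) (P * sin c + Q * cos c) = csqr P Q.
  have := cos2Dsin2 c; rewrite /csqr => h.
  by rewrite -[RHS]mulr1 -h; ring.
rewrite -[RHS]rot /csqr !(big_rem j js)/=.
have shiftn n : n \in rem j s ->
    2 * pi * dotZR n (tshift (fun i => t * v i) x) = 2 * pi * dotZR n x + 2 * pi * t + c.
  rewrite mem_rem_uniq// inE => /andP[nj ns].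
  by rewrite dotZR_shift dotvZ (jv _ ns nj) /c; ring.
have shiftj : 2 * pi * dotZR j (tshift (fun i => t * v i) x) = 2 * pi * dotZR j x + c.
  by rewrite dotZR_shift dotvZ /c; ring.
rewrite shiftj cosD sinD /X /Y; congr (_ ^+ 2 + _ ^+ 2).
  rewrite (_ : \sum_(n <- rem j s) a n * cos (2 * pi * dotZR n (tshift _ x)) =
   (X * cos (2 * pi * t) - Y * sin (2 * pi * t)) * cos c -
   (X * sin (2 * pi * t) + Y * cos (2 * pi * t)) * sin c); first by rewrite -/X -/Y; ring.
  rewrite /X /Y !mulr_suml -sumrB -big_split/= !mulr_suml -sumrB.
  rewrite big_seq [RHS]big_seq; apply: eq_bigr => n ns.
  by rewrite shiftn// !cosD !sinD; ring.
rewrite (_ : \sum_(n <- rem j s) a n * sin (2 * pi * dotZR n (tshift _ x)) =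
   (X * cos (2 * pi * t) - Y * sin (2 * pi * t)) * sin c +
   (X * sin (2 * pi * t) + Y * cos (2 * pi * t)) * cos c); first by rewrite -/X -/Y; ring.
rewrite /X /Y !mulr_suml -sumrB -big_split/= !mulr_suml -big_split/=.
rewrite big_seq [RHS]big_seq; apply: eq_bigr => n ns.
by rewrite shiftn// !(sinD, cosD); ring.
Qed.

Lemma measurable_mean1 (F : measurableTypeR R * T -> R) :
  bounded_measurable F -> (forall z, 0 <= F z) ->
  measurable_fun setT (fun x => (mean1 (fun t => F (t, x)))%:E).
Proof.
move=> bF F0.
pose D := (`[0, 1]%classic `*` setT : set (measurableTypeR R * T)).
have mD : measurable D by exact: measurableX.
rewrite (_ : (fun x => _) = fubini_G (@lebesgue_measure R) ((EFin \o F) \_ D)).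
  apply: measurable_fun_fubini_tonelli_G.
    apply/(measurable_restrictT _ mD)/measurable_funTS.
    by apply/measurable_EFinP; case: bF.
  by move=> z; rewrite patchE; case: ifP => // _; rewrite lee_fin.
apply: funext => x; rewrite /fubini_G.
have bFx : bounded_measurable (fun t => F (t, x)).
  have [mF [C FC]] := bF; split; last by exists C => t; exact: (FC (t, x)).
  exact: (measurableT_comp mF (pair2_measurable x)).
rewrite -(integral_mean _ lebesgue_01 bFx); last by [].
rewrite integral_mkcond; apply: eq_integral => t _; rewrite !patchE.
rewrite (_ : ((t, x) \in D) = (t \in `[0, 1]%classic))//.
by apply/idP/idP; rewrite !inE//; case.
Qed.

Definition line_tsqr q s a (v : 'I_d -> R) (z : measurableTypeR R * T) : R :=
  tsqr s a (tshift (fun i => z.1 * v i) z.2) `^ q.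

Lemma bounded_measurable_line_tsqr q s a v : 0 <= q ->
  bounded_measurable (line_tsqr q s a v).
Proof.
move=> q0; have bq := bounded_measurable_tsqr_powR s a q0.
have mshift : measurable_fun setT (fun z : measurableTypeR R * T =>
    tshift (fun i => (z.1 * v i)%R) z.2).
  apply/measurable_fun_tnthP => i.
  rewrite (_ : _ \o _ = fun z : measurableTypeR R * T => tnth z.2 i + z.1 * v i).
    apply: measurable_funD; last exact: measurable_funM.
    exact: (measurableT_comp (@measurable_tnth _ _ _ i) measurable_snd).
  by apply: funext => z /=; rewrite tnth_tshift.
have [mq [C qC]] := bq; split; last by exists C => z; exact: qC.
exact: (measurableT_comp mq mshift).
Qed.

(** The mean is the same after every translation along v, hence equals its average over t in [0, 1];
    Tonelli then puts the t-integral inside. *)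
Lemma mean_tsqr_average q s a (v : 'I_d -> R) : 0 <= q ->
  (mean (fun x => tsqr s a x `^ q))%:E =
  (\int[lebesgue_tuple R d]_(x in cube)
    (mean1 (fun t : measurableTypeR R => line_tsqr q s a v (t, x)))%:E)%E.
Proof.
move=> q0; have bq := bounded_measurable_tsqr_powR s a q0.
have mD := @measurable_unit_cube R d; have I1 := @lebesgue_unit_cube R d.
pose F := line_tsqr q s a v.
have bF : bounded_measurable F by exact: bounded_measurable_line_tsqr.
have pq : Zperiodic (fun x => tsqr s a x `^ q).
  by move=> z x; rewrite Zperiodic_tsqr.
transitivity (\int[@lebesgue_measure R]_(t in `[0%R, 1%R])
    \int[lebesgue_tuple R d]_(x in cube) (F (t, x))%:E)%E.
  transitivity (\int[@lebesgue_measure R]_(t in `[0%R, 1%R])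
    (mean (fun x => tsqr s a x `^ q))%:E)%E.
    by rewrite integral_cst//= lebesgue_01 mule1.
  apply: eq_integral => t _; rewrite -(mean_cube_shift (fun i => t * v i) bq pq).
  have bFt : bounded_measurable (fun x => F (t, x)).
    have [mF [C FC]] := bF; split; last by exists C => x; exact: (FC (t, x)).
    exact: (measurableT_comp mF (pair1_measurable t)).
  exact/esym/(integral_mean mD I1 bFt).
rewrite (@ge0_integral_cube_swap R d (EFin \o F)); last 2 first.
- by apply/measurable_EFinP; case: bF.
- by move=> z; rewrite lee_fin powR_ge0.
apply: eq_integral => x _.
have bFx : bounded_measurable (fun t => F (t, x)).
  have [mF [C FC]] := bF; split; last by exists C => t; exact: (FC (t, x)).
  exact: (measurableT_comp mF (pair2_measurable x)).
exact: (integral_mean _ lebesgue_01 bFx).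
Qed.

Lemma mean_tsqr_mono1 q s a a' (v : 'I_d -> R) j : 0 < q -> uniq s -> j \in s ->
  (forall n, n \in s -> n != j -> dotv n v = dotv j v + 1) ->
  (forall n, n != j -> a n = a' n) -> `|a j| <= `|a' j| ->
  mean (fun x => tsqr s a x `^ q) <= mean (fun x => tsqr s a' x `^ q).
Proof.
move=> q0 us js jv aa' aj; rewrite -lee_fin.
rewrite [leLHS](mean_tsqr_average s a v (ltW q0)).
rewrite [leRHS](mean_tsqr_average s a' v (ltW q0)).
have line0 b z : 0 <= line_tsqr q s b v z by exact: powR_ge0.
have mline b : measurable_fun cube (fun x => (mean1 (fun t => line_tsqr q s b v (t, x)))%:E).
  apply: measurable_funTS; apply: measurable_mean1 => //.
  by apply: bounded_measurable_line_tsqr; exact: ltW.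
apply: ge0_le_integral; [exact: measurable_unit_cube| |exact: mline|exact: mline|].
  by move=> x _; rewrite lee_fin; apply: Rintegral_ge0 => t _; exact: line0.
move=> x _; rewrite lee_fin.
(* The remaining sum X + i Y, hence the radius [r] below, is common to both families; only the
   modulus of the coefficient at j differs. *)
pose X := \sum_(n <- rem j s) a n * cos (2 * pi * dotZR n x).
pose Y := \sum_(n <- rem j s) a n * sin (2 * pi * dotZR n x).
have aa'r n : n \in rem j s -> a' n = a n.
  by rewrite mem_rem_uniq// inE => /andP[nj _]; rewrite aa'.
have XE : \sum_(n <- rem j s) a' n * cos (2 * pi * dotZR n x) = X.
  by rewrite big_seq [RHS]big_seq; apply: eq_bigr => n /aa'r ->.
have YE : \sum_(n <- rem j s) a' n * sin (2 * pi * dotZR n x) = Y.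
  by rewrite big_seq [RHS]big_seq; apply: eq_bigr => n /aa'r ->.
have [r r0 rE] := mean1_csqr X Y (ltW q0).
have E b : \sum_(n <- rem j s) b n * cos (2 * pi * dotZR n x) = X ->
    \sum_(n <- rem j s) b n * sin (2 * pi * dotZR n x) = Y ->
    mean1 (fun t : measurableTypeR R => line_tsqr q s b v (t, x))
    = mean1 (fun t : measurableTypeR R => circ `|b j| r t `^ q).
  move=> bX bY; rewrite -(rE (b j) (dotZR j x)).
  by apply: eq_Rintegral => t _; rewrite /line_tsqr (tsqr_shift _ _ _ us js jv) bX bY.
rewrite (E a erefl erefl) (E a' XE YE).
by apply: mean_circ_mono => //; exact: normr_ge0.
Qed.

Lemma mean_tsqr_majorant q s a A : 0 < q -> uniq s ->
  (forall j, j \in s -> exists v : 'I_d -> R,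
    forall n, n \in s -> n != j -> dotv n v = dotv j v + 1) ->
  (forall n, n \in s -> `|a n| <= A n) ->
  mean (fun x => tsqr s a x `^ q) <= mean (fun x => tsqr s A x `^ q).
Proof.
move=> q0 us dual aA.
(* Hybrid families: the coefficients are replaced one frequency at a time. *)
pose b (r : seq 'rV[int]_d) n := if n \in r then A n else a n.
have step (r : seq 'rV[int]_d) : {subset r <= s} ->
    mean (fun x => tsqr s a x `^ q) <= mean (fun x => tsqr s (b r) x `^ q).
  elim: r => [_|j r IHr jrs]; first exact: lexx.
  have js : j \in s by apply: jrs; rewrite mem_head.
  have rs : {subset r <= s} by move=> n nr; apply: jrs; rewrite inE nr orbT.
  apply: le_trans (IHr rs) _; have [v vP] := dual _ js.
  apply: (mean_tsqr_mono1 q0 us js vP).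
    by move=> n nj; rewrite /b inE (negbTE nj).
  rewrite /b mem_head; case: ifP => // _.
  by rewrite (le_trans (aA _ js))// ler_norm.
have <- : mean (fun x => tsqr s (b s) x `^ q) = mean (fun x => tsqr s A x `^ q).
  apply: eq_Rintegral => x _; congr (_ `^ q).
  by rewrite /tsqr /tcos /tsin; congr (_ ^+ 2 + _ ^+ 2);
    rewrite big_seq [RHS]big_seq; apply: eq_bigr => n ns; rewrite /b ns.
exact: step.
Qed.

(** The sum of the coordinate forms of a free family takes the value 1 at each member. *)
Lemma free_dual (K : fieldType) (k : nat) (S : seq 'rV[K]_k) : free S ->
  exists v : 'I_k -> K, forall u, u \in S -> \sum_i u 0 i * v i = 1.
Proof.
move=> fS; pose X := in_tuple S.
exists (fun i => \sum_l coord X l (delta_mx 0 i)) => u /(nthP 0)[j jS <-].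
have E l : coord X l S`_j = \sum_i S`_j 0 i * coord X l (delta_mx 0 i).
  rewrite {1}[S`_j]row_sum_delta linear_sum; apply: eq_bigr => i _.
  by rewrite linearZ.
under eq_bigr do rewrite mulr_sumr.
rewrite exchange_big/= -[RHS](_ : \sum_l coord X l S`_j = 1).
  by apply: eq_bigr => l _; rewrite E.
have cf l : coord X l S`_j = (Ordinal jS == l)%:R.
  exact: (@coord_free K _ _ X (Ordinal jS) l fS).
rewrite (bigD1 (Ordinal jS))//= cf eqxx big1 ?addr0// => l lj.
by rewrite cf eq_sym (negbTE lj).
Qed.

Lemma affinely_independent_dual (Gamma : set 'rV[int]_d) s j :
  affinely_independent R Gamma -> uniq s -> [set` s] `<=` Gamma -> j \in s ->
  exists v : 'I_d -> R, forall n, n \in s -> n != j -> dotv n v = dotv j v + 1.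
Proof.
move=> indep us sG js.
pose f n : 'rV[R]_d := map_mx (fun z : int => z%:~R : R) (n - j).
have finj : injective f.
  move=> m n /matrixP fmn; apply: (addIr (- j)); apply/matrixP => i k.
  by have := fmn i k; rewrite !mxE => /intr_inj.
have [|v vP] := @free_dual R d [seq f n | n <- rem j s].
  apply: (indep j (sG _ js)).
    by rewrite map_inj_uniq// rem_uniq.
  move=> u /= /mapP[n]; rewrite mem_rem_uniq// inE => /andP[nj ns] ->.
  by exists n => //; split; [exact: sG|exact/eqP].
exists v => n ns nj; apply: (addrI (- dotv j v)).
rewrite addKr addrC -dotvB -[RHS](vP (f n)).
  by apply: eq_bigr => i _; rewrite /f [in RHS]mxE.
by apply: map_f; rewrite mem_rem_uniq// inE nj.
Qed.

Lemma strict_majorant_of_affinely_independent (Gamma : set 'rV[int]_d) (p : R) :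
  affinely_independent R Gamma -> 0 < p -> strict_majorant Gamma p.
Proof.
move=> indep p0 a A fa fA aA.
have [r rE] : exists r : seq 'rV[int]_d,
    [set n | Gamma n /\ a n != 0] `|` [set n | Gamma n /\ A n != 0] = [set` r].
  by apply/finite_seqP; rewrite finite_setU.
pose s := undup r.
have us : uniq s by exact: undup_uniq.
have sE n : n \in s <-> Gamma n /\ (a n != 0 \/ A n != 0).
  rewrite mem_undup -[X in X <-> _]/([set` r] n) -rE /=.
  by split=> [[[? ?]|[? ?]]|[? [?|?]]]; tauto.
have sG : [set` s] `<=` Gamma by move=> n /sE[].
have a0 n : Gamma n -> n \notin s -> a n = 0.
  by move=> Gn /negP ns; apply/eqP; apply: contraT => an; case: ns; apply/sE; tauto.
have A0 n : Gamma n -> n \notin s -> A n = 0.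
  by move=> Gn /negP ns; apply/eqP; apply: contraT => an; case: ns; apply/sE; tauto.
rewrite (cube_Lnorm_exp_sum p0 us sG a0) (cube_Lnorm_exp_sum p0 us sG A0) lee_fin.
apply: ler_powR_base; [by rewrite invr_ge0 ltW|exact: mean_tsqr_ge0|].
apply: mean_tsqr_majorant => //; first by rewrite divr_gt0.
  by move=> j js; exact: affinely_independent_dual sG js.
by move=> n ns; apply: aA; exact: sG.
Qed.

End majorant.

(** * The binomial series *)

Section generalized_binomial.
Context {R : realType}.
Implicit Types (q : R) (m k l : nat).

Fixpoint gbin (q : R) (k : nat) : R :=
  if k is j.+1 then gbin q j * ((q - j%:R) / j.+1%:R) else 1.

Arguments gbin : simpl never.

Lemma gbin_recr q k : gbin q k.+1 = gbin q k * ((q - k%:R) / k.+1%:R).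
Proof. by []. Qed.

Lemma gbinS q k : k.+1%:R * gbin q k.+1 = (q - k%:R) * gbin q k.
Proof. by rewrite gbin_recr mulrCA [_.+1%:R * _]mulrC divfK ?pnatr_eq0// mulrC. Qed.

Lemma gbin_gt0 q m k : m%:R < q -> (k <= m.+1)%N -> 0 < gbin q k.
Proof.
move=> mq; elim: k => [|k IHk] km; first exact: ltr01.
rewrite gbin_recr mulr_gt0 ?IHk ?(ltnW km)// divr_gt0// subr_gt0.
by apply: le_lt_trans mq; rewrite ler_nat.
Qed.

(** Only the last factor q - (m + 1) is negative. *)
Lemma gbin_lt0 q m : m%:R < q < m.+1%:R -> gbin q m.+2 < 0.
Proof.
move=> /andP[mq qm]; rewrite gbin_recr.
rewrite pmulr_rlt0 ?(gbin_gt0 mq)//.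
by rewrite pmulr_llt0 ?invr_gt0// subr_lt0.
Qed.

Lemma norm_gbinS q k : `|gbin q k.+1| = `|gbin q k| * (`|q - k%:R| / k.+1%:R).
Proof. by rewrite gbin_recr normrM normf_div [`|k.+1%:R|]ger0_norm. Qed.

(** From index m + 1 on, the ratio |q - k| / (k + 1) of consecutive coefficients is at most 1. *)
Lemma le_norm_gbin q m k l : m%:R < q < m.+1%:R -> (m.+1 <= k)%N -> (k <= l)%N ->
  `|gbin q l| <= `|gbin q k|.
Proof.
move=> /andP[mq qm] mk; elim: l => [|l IHl]; first by rewrite leqn0 => /eqP->.
rewrite leq_eqVlt => /predU1P[<-//|]; rewrite ltnS => kl.
apply: le_trans (IHl kl); rewrite norm_gbinS ler_piMr//.
have ml : m.+1%:R <= l%:R :> R by rewrite ler_nat (leq_trans mk).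
rewrite ler_pdivrMr// mul1r ler0_norm ?subr_le0; last by lra.
by rewrite -natr1; have := ler0n R m; lra.
Qed.

(** Each ratio up to index m is at most m + 1, and later ones are at most 1. The bound is relative
    to [gbin q k], because [gbin q m.+1] tends to 0 as q tends to m. *)
Lemma norm_gbin_le q m k l : m%:R < q < m.+1%:R -> (k <= m.+1)%N -> (k <= l)%N ->
  `|gbin q l| <= m.+1%:R ^+ m.+1 * gbin q k.
Proof.
move=> mq km kl; have /andP[mq1 qm] := mq; have gk := gbin_gt0 mq1 km.
have M1 : 1 <= m.+1%:R :> R by rewrite ler1n.
suff H : forall j, (k <= j)%N -> (j <= m.+1)%N -> `|gbin q j| <= m.+1%:R ^+ j * gbin q k.
  have [lm|ml] := leqP l m.+1.
    apply: le_trans (H l kl lm) _; rewrite ler_wpM2r ?(ltW gk)//.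
    by apply: ler_weXn2l.
  apply: le_trans (le_norm_gbin mq (leqnn _) (ltnW ml)) _; exact: H.
elim=> [|j IHj] kj jm.
  by move: kj; rewrite leqn0 => /eqP ->; rewrite expr0 mul1r normr1.
move: kj; rewrite leq_eqVlt => /predU1P[<-|].
  by rewrite ger0_norm ?(ltW gk)// ler_peMl ?(ltW gk)// exprn_ege1.
rewrite ltnS => kj; rewrite norm_gbinS exprSr mulrAC.
apply: ler_pM; rewrite ?normr_ge0 ?divr_ge0 ?normr_ge0 ?IHj//; first exact: ltnW.
have jm' : j%:R <= m%:R :> R by rewrite ler_nat.
rewrite ger0_norm ?subr_ge0; last by lra.
rewrite ler_pdivrMr// (le_trans (_ : _ <= q))//; first by rewrite gerBl.
apply: ltW; apply: lt_le_trans qm _.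
by rewrite ler_peMr// ler1n.
Qed.

(** By [gbinS] the left-hand side is |(q - k) C(q, k)|, the coefficient of the remainder in
    [binomial_ode]; it is nonincreasing for k >= m. *)
Lemma gbinM_le q m k : m%:R < q < m.+1%:R -> (m <= k)%N ->
  k.+1%:R * `|gbin q k.+1| <= m.+1%:R * `|gbin q m.+1|.
Proof.
move=> mq; have /andP[mq1 qm] := mq; elim: k => [|k IHk].
  by rewrite leqn0 => /eqP ->.
rewrite leq_eqVlt => /predU1P[<-//|]; rewrite ltnS => mk.
apply: le_trans (IHk mk); rewrite norm_gbinS [leLHS]mulrC -mulrA divfK ?pnatr_eq0//.
rewrite mulrC ler_wpM2r//.
have mk' : m.+1%:R <= k.+1%:R :> R by rewrite ler_nat.
rewrite ler0_norm ?subr_le0; last by lra.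
by have := ler0n R m; lra.
Qed.

End generalized_binomial.

Section binomial_series.
Context {R : realType}.
Implicit Types (q rho t : R) (w : R[i]).
Local Notation Re := complex.Re.
Local Notation Im := complex.Im.

Lemma Re_mulc (z w : R[i]) : Re (z * w) = Re z * Re w - Im z * Im w.
Proof. by case: z w => a b [c e]. Qed.

Lemma Im_mulc (z w : R[i]) : Im (z * w) = Re z * Im w + Im z * Re w.
Proof. by case: z w => a b [c e]. Qed.

Definition sqc (z : R[i]) := Re z ^+ 2 + Im z ^+ 2.

Lemma sqc_ge0 z : 0 <= sqc z.
Proof. by rewrite addr_ge0 ?sqr_ge0. Qed.

Lemma sqcM z w : sqc (z * w) = sqc z * sqc w.
Proof. by rewrite /sqc Re_mulc Im_mulc; ring. Qed.

Lemma sqcX z n : sqc (z ^+ n) = sqc z ^+ n.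
Proof.
elim: n => [|n IHn]; first by rewrite !expr0 /sqc /= expr1n expr0n addr0.
by rewrite !exprS sqcM IHn.
Qed.

(** Real and imaginary parts of the partial sum of (1 + w X)^q, as real polynomials in X so that
    formal derivatives apply. *)
Definition repoly q w N : {poly R} :=
  \sum_(k < N.+1) (gbin q k * Re (w ^+ k))%:P * 'X^k.
Definition impoly q w N : {poly R} :=
  \sum_(k < N.+1) (gbin q k * Im (w ^+ k))%:P * 'X^k.

(* With S = repoly + i impoly: (1 + w X) S' = w (q S - (q - N) gbin q N (w X)^N). *)
Lemma binomial_ode q w N :
  let x := (Re w)%:P in let y := (Im w)%:P in
  let c := ((q - N%:R) * gbin q N)%:P in
  let e := c * (Re (w ^+ N))%:P * 'X^N in
  let f := c * (Im (w ^+ N))%:P * 'X^N in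
  let p := repoly q w N in let r := impoly q w N in
  (1 + x * 'X) * p^`() - y * 'X * r^`() =
    x * (q%:P * p - e) - y * (q%:P * r - f) /\
  (1 + x * 'X) * r^`() + y * 'X * p^`() =
    x * (q%:P * r - f) + y * (q%:P * p - e).
Proof.
rewrite /=; elim: N => [|N [IHr IHi]].
  rewrite /repoly /impoly !big_ord1 /= !expr0 !mulr1 !derivC !mulr0 subr0 addr0.
  by rewrite subr0 subrr !mulr0 subr0 addr0.
have rS : repoly q w N.+1 = repoly q w N +
    (gbin q N.+1)%:P * ((Re w)%:P * (Re (w ^+ N))%:P - (Im w)%:P * (Im (w ^+ N))%:P) * ('X * 'X^N).
  by rewrite {1}/repoly big_ord_recr/= -exprS !exprS Re_mulc !(polyCM, polyCB).
have iS : impoly q w N.+1 = impoly q w N +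
    (gbin q N.+1)%:P * ((Re w)%:P * (Im (w ^+ N))%:P + (Im w)%:P * (Re (w ^+ N))%:P) * ('X * 'X^N).
  by rewrite {1}/impoly big_ord_recr/= -exprS !exprS Im_mulc !(polyCM, polyCD).
have dX : ('X * 'X^N)^`() = N.+1%:R%:P * 'X^N :> {poly R}.
  by rewrite -exprS derivXn /= -mulr_natl polyC_natr.
have drS : (repoly q w N.+1)^`() = (repoly q w N)^`() +
    (gbin q N.+1)%:P * ((Re w)%:P * (Re (w ^+ N))%:P - (Im w)%:P * (Im (w ^+ N))%:P) * (N.+1%:R%:P * 'X^N).
  by rewrite rS derivD -!(polyCM, polyCB) mul_polyC derivZ dX -mul_polyC.
have diS : (impoly q w N.+1)^`() = (impoly q w N)^`() +
    (gbin q N.+1)%:P * ((Re w)%:P * (Im (w ^+ N))%:P + (Im w)%:P * (Re (w ^+ N))%:P) * (N.+1%:R%:P * 'X^N).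
  by rewrite iS derivD -!(polyCM, polyCD) mul_polyC derivZ dX -mul_polyC.
rewrite drS diS rS iS; move: IHr IHi.
rewrite -(gbinS q N) !exprS Re_mulc Im_mulc; move: (gbin q N.+1) => g.
rewrite !(polyCM, polyCD, polyCB).
set p := repoly q w N; set r := impoly q w N; set dp := p^`(); set dr := r^`().
set x := (Re w)%:P; set y := (Im w)%:P; set u := (Re (w ^+ N))%:P.
set v := (Im (w ^+ N))%:P; set C := g%:P; set n1 := N.+1%:R%:P.
move=> IHr IHi; split.
  transitivity ((1 + x * 'X) * dp - y * 'X * dr + (1 + x * 'X) * C * (x * u - y * v) * n1 * 'X^N
    - y * 'X * C * (x * v + y * u) * n1 * 'X^N); first by ring.
  by rewrite IHr; ring.
transitivity ((1 + x * 'X) * dr + y * 'X * dp + (1 + x * 'X) * C * (x * v + y * u) * n1 * 'X^N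
    + y * 'X * C * (x * u - y * v) * n1 * 'X^N); first by ring.
by rewrite IHi; ring.
Qed.

Definition gbin_sum q N (z : R[i]) : R[i] :=
  \sum_(k < N.+1) ((gbin q k)%:C)%C * z ^+ k.

Lemma Re_gbin_sum q N w : Re (gbin_sum q N w) = (repoly q w N).[1].
Proof.
rewrite /gbin_sum /repoly raddf_sum horner_sum; apply: eq_bigr => k _.
by rewrite /= Re_mulc/= mul0r subr0 !hornerE expr1n mulr1.
Qed.

Lemma Im_gbin_sum q N w : Im (gbin_sum q N w) = (impoly q w N).[1].
Proof.
rewrite /gbin_sum /impoly raddf_sum horner_sum; apply: eq_bigr => k _.
by rewrite /= Im_mulc/= mul0r addr0 !hornerE expr1n mulr1.
Qed.

Lemma norm_Re_le w rho : 0 <= rho -> sqc w <= rho ^+ 2 -> `|Re w| <= rho.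
Proof.
move=> rho0 h; rewrite -(ger0_norm rho0) -!sqrtr_sqr ler_wsqrtr//.
by apply: le_trans h; rewrite lerDl sqr_ge0.
Qed.

Lemma norm_Im_le w rho : 0 <= rho -> sqc w <= rho ^+ 2 -> `|Im w| <= rho.
Proof.
move=> rho0 h; rewrite -(ger0_norm rho0) -!sqrtr_sqr ler_wsqrtr//.
by apply: le_trans h; rewrite lerDr sqr_ge0.
Qed.

(** |1 + t w|^2 as a polynomial in t. *)
Definition line_sqr w : {poly R} :=
  (1 + (Re w)%:P * 'X) ^+ 2 + ((Im w)%:P * 'X) ^+ 2.

(* |S(t w)|^2 / |1 + t w|^(2 q) for the partial sum S of the binomial series;
   it is 1 at t = 0, and its derivative is small by [binomial_ode]. *)
Definition line_ratio q w N (t : R) : R :=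
  ((repoly q w N).[t] ^+ 2 + (impoly q w N).[t] ^+ 2) *
    expR (- q * ln (line_sqr w).[t]).

(** Here A + i B = 1 + t w. By the differential equation the terms proportional to q cancel against
    the derivative of |1 + t w|^(-2 q), leaving only the remainder e + i f. *)
Lemma is_derive_line_ratio q w N t : 0 < (line_sqr w).[t] ->
  let p := (repoly q w N).[t] in let r := (impoly q w N).[t] in
  let x := Re w in let y := Im w in
  let A := 1 + x * t in let B := y * t in
  let e := (q - N%:R) * gbin q N * Re (w ^+ N) * t ^+ N in
  let f := (q - N%:R) * gbin q N * Im (w ^+ N) * t ^+ N in
  is_derive t 1 (line_ratio q w N)
    (- 2 * expR (- q * ln (line_sqr w).[t]) / (line_sqr w).[t] *
     (p * (A * (x * e - y * f) + B * (x * f + y * e)) +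
      r * (A * (x * f + y * e) - B * (x * e - y * f)))).
Proof.
move=> D0 p r x y A B e f.
pose P := repoly q w N; pose S := impoly q w N; pose D := line_sqr w.
have dD : is_derive D.[t] 1 (@ln R) (D.[t])^-1 by exact: is_derive1_ln.
have dlnD : is_derive t 1 (@ln R \o horner D) ((D.[t])^-1 * D^`().[t]).
  exact: is_derive1_comp.
have dE : is_derive t 1 (expR \o ((- q) *: (@ln R \o horner D)))
    (expR (- q * ln D.[t]) * (- q * ((D.[t])^-1 * D^`().[t]))).
  by apply: is_derive1_comp.
have dN : is_derive t 1 (horner P ^+ 2 + horner S ^+ 2)
    ((2 * P.[t] ^+ 1) *: P^`().[t] + (2 * S.[t] ^+ 1) *: S^`().[t]).
  by apply: is_deriveD; exact: is_deriveX.
have dF := is_deriveM dN dE.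
have -> : line_ratio q w N = (horner P ^+ 2 + horner S ^+ 2) *
    (expR \o ((- q) *: (@ln R \o horner D))).
  by apply: funext => u.
apply: (is_derive_eq dF) => /=.
have [] := binomial_ode q w N.
move=> /(congr1 (horner^~ t)) /= hr /(congr1 (horner^~ t)) /= hi.
have DE : D.[t] = A ^+ 2 + B ^+ 2 by rewrite /D /line_sqr !hornerE.
have D'E : D^`().[t] = 2 * (A * x + B * y).
  rewrite /D /line_sqr !expr2 !(derivM, derivD, derivC, derivX).
  rewrite !(hornerD, hornerM, hornerC, hornerX, horner0).
  rewrite /A /B -/x -/y; ring.
have {}hr : A * P^`().[t] - B * S^`().[t] = x * (q * p - e) - y * (q * r - f).
  by move: hr; rewrite !(hornerD, hornerN, hornerM, hornerC, hornerX, hornerXn)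
    -/P -/S -/p -/r -/x -/y => hr; rewrite /A /B hr /e /f; ring.
have {}hi : A * S^`().[t] + B * P^`().[t] = x * (q * r - f) + y * (q * p - e).
  by move: hi; rewrite !(hornerD, hornerN, hornerM, hornerC, hornerX, hornerXn)
    -/P -/S -/p -/r -/x -/y => hi; rewrite /A /B hi /e /f; ring.
(* [hr] and [hi] form a linear system for the two derivatives, with determinant A^2 + B^2. *)
have PE : P^`().[t] = (A * (x * (q * p - e) - y * (q * r - f))
    + B * (x * (q * r - f) + y * (q * p - e))) / D.[t].
  apply: (@mulIf _ D.[t]); first by rewrite gt_eqF.
  by rewrite divfK ?gt_eqF// -hr -hi DE; ring.
have SE : S^`().[t] = (A * (x * (q * r - f) + y * (q * p - e))
    - B * (x * (q * p - e) - y * (q * r - f))) / D.[t].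
  apply: (@mulIf _ D.[t]); first by rewrite gt_eqF.
  by rewrite divfK ?gt_eqF// -hr -hi DE; ring.
rewrite (_ : (horner P ^+ 2 + horner S ^+ 2) t = p ^+ 2 + r ^+ 2)//.
rewrite (_ : (- q *: (@ln R \o horner D)) t = - q * ln D.[t])//.
rewrite PE SE D'E -/D /GRing.scale /=; move: (expR _) => E.
have D00 : D.[t] != 0 by rewrite gt_eqF.
move: D00; rewrite DE => D00.
rewrite -/P -/S -/p -/r.
field.
exact: D00.
Qed.

Lemma sum_exprs_le rho N : 0 <= rho < 1 -> \sum_(k < N) rho ^+ k <= (1 - rho)^-1.
Proof.
move=> /andP[rho0 rho1]; have d0 : 0 < 1 - rho by rewrite subr_gt0.
rewrite -[leRHS]mul1r ler_pdivlMr// mulrC.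
have -> : (1 - rho) * \sum_(k < N) rho ^+ k = 1 - rho ^+ N.
  by rewrite -[RHS]opprB subrX1 -mulNr opprB.
by rewrite gerBl exprn_ge0.
Qed.

Lemma norm_poly_le q K rho N t (z : nat -> R) : 0 <= rho < 1 -> 0 <= t <= 1 ->
  (forall k, `|gbin q k| <= K) -> (forall k, `|z k| <= rho ^+ k) ->
  `|(\sum_(k < N) (gbin q k * z k)%:P * 'X^k).[t]| <= K * (1 - rho)^-1.
Proof.
move=> r01 /andP[t0 t1] gK zr; have K0 : 0 <= K := le_trans (normr_ge0 _) (gK 0%N).
rewrite horner_sum; apply: le_trans (ler_norm_sum _ _ _) _.
apply: le_trans (ler_wpM2l K0 (sum_exprs_le N r01)); rewrite mulr_sumr.
apply: ler_sum => k _; rewrite !(hornerM, hornerC, hornerXn) normrM.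
rewrite -[leRHS]mulr1; apply: ler_pM => //.
  by rewrite normrM; apply: ler_pM.
by rewrite ger0_norm ?exprn_ge0// exprn_ile1.
Qed.

Lemma line_sqrE w t : (line_sqr w).[t] = (1 + Re w * t) ^+ 2 + (Im w * t) ^+ 2.
Proof. by rewrite /line_sqr !expr2 !(hornerD, hornerM, hornerC, hornerX). Qed.

Lemma line_sqr_ge w rho t : 0 <= rho < 1 -> sqc w <= rho ^+ 2 -> 0 <= t <= 1 ->
  (1 - rho) ^+ 2 <= (line_sqr w).[t].
Proof.
move=> /andP[rho0 rho1] wr /andP[t0 t1].
rewrite line_sqrE -[leLHS]addr0 lerD ?sqr_ge0//.
have := norm_Re_le rho0 wr; rewrite ler_norml => /andP[xl _].
have : 1 - rho <= 1 + Re w * t by nra.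
by move=> h; rewrite ler_sqr ?nnegrE//; lra.
Qed.

Lemma line_sqr_le w rho t : 0 <= rho < 1 -> sqc w <= rho ^+ 2 -> 0 <= t <= 1 ->
  (line_sqr w).[t] <= 4.
Proof.
move=> /andP[rho0 rho1] wr /andP[t0 t1]; rewrite line_sqrE.
have := norm_Re_le rho0 wr; rewrite ler_norml => /andP[_ xu].
have : (Re w * t) ^+ 2 + (Im w * t) ^+ 2 <= 1.
  rewrite !exprMn -mulrDl mulr_ile1 ?sqr_ge0 ?sqc_ge0//.
    by rewrite (le_trans wr)// expr_le1// ltW.
  by rewrite expr_le1.
have : Re w * t <= 1 by nra.
by rewrite [(1 + _) ^+ 2]sqrrD; lra.
Qed.

(** The bracket in [is_derive_line_ratio]; 12 = 2 (2 + 1) 2 by the triangle inequality. *)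
Lemma norm_bracket_le (H e0 p r A B x y e f : R) : 0 <= H -> 0 <= e0 ->
  `|p| <= H -> `|r| <= H -> `|A| <= 2 -> `|B| <= 1 -> `|x| <= 1 -> `|y| <= 1 ->
  `|e| <= e0 -> `|f| <= e0 ->
  `|p * (A * (x * e - y * f) + B * (x * f + y * e)) +
    r * (A * (x * f + y * e) - B * (x * e - y * f))| <= 12 * H * e0.
Proof.
move=> H0 e00 pH rH A2 B1 x1 y1 ee fe.
have prod1 (u v : R) : `|u| <= 1 -> `|v| <= e0 -> `|u * v| <= e0.
  by move=> u1 ve; rewrite normrM -[e0]mul1r; apply: ler_pM.
have s1 : `|x * e - y * f| <= 2 * e0.
  by have := ler_normB (x * e) (y * f); have := prod1 _ _ x1 ee; have := prod1 _ _ y1 fe; lra.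
have s2 : `|x * f + y * e| <= 2 * e0.
  by have := ler_normD (x * f) (y * e); have := prod1 _ _ x1 fe; have := prod1 _ _ y1 ee; lra.
have b1 (u v : R) : `|u| <= 2 * e0 -> `|v| <= 2 * e0 ->
    `|A * u + B * v| <= 6 * e0 /\ `|A * u - B * v| <= 6 * e0.
  move=> ue ve; have h1 : `|A * u| <= 4 * e0.
    by rewrite normrM (_ : 4 * e0 = 2 * (2 * e0)); [apply: ler_pM|ring].
  have h2 : `|B * v| <= 2 * e0 by rewrite normrM -[2 * e0]mul1r; apply: ler_pM.
  by split; [have := ler_normD (A * u) (B * v)|have := ler_normB (A * u) (B * v)]; lra.
have [t1 _] := b1 _ _ s1 s2; have [_ t2] := b1 _ _ s2 s1.
have h1 : `|p * (A * (x * e - y * f) + B * (x * f + y * e))| <= H * (6 * e0).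
  by rewrite normrM; apply: ler_pM.
have h2 : `|r * (A * (x * f + y * e) - B * (x * e - y * f))| <= H * (6 * e0).
  by rewrite normrM; apply: ler_pM.
by rewrite (le_trans (ler_normD _ _))//; lra.
Qed.

(** Mean value theorem on [0, 1]: the ratio is 1 at 0 and its derivative carries the factor
    rho^N. *)
Lemma line_ratio_diff q K L rho N w : 0 <= q -> 0 <= rho < 1 -> sqc w <= rho ^+ 2 ->
  (forall k, `|gbin q k| <= K) -> N.+1%:R * `|gbin q N.+1| <= L ->
  `|line_ratio q w N 1 - 1| <=
  2 * expR (- q * ln ((1 - rho) ^+ 2)) / (1 - rho) ^+ 2 *
    (12 * (K * (1 - rho)^-1) * (L * rho ^+ N)).
Proof.
move=> q0 r01 wr gK gL; have /andP[rho0 rho1] := r01.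
have K0 : 0 <= K := le_trans (normr_ge0 _) (gK 0%N).
have L0 : 0 <= L by apply: le_trans gL; exact: mulr_ge0.
have ge t : 0 <= t <= 1 -> (1 - rho) ^+ 2 <= (line_sqr w).[t] by exact: line_sqr_ge.
have d0 : 0 < (1 - rho) ^+ 2 by rewrite exprn_gt0// subr_gt0.
have D0 t : 0 <= t <= 1 -> 0 < (line_sqr w).[t] by move=> /ge; exact: lt_le_trans.
have der t (t01 : 0 <= t <= 1) := is_derive_line_ratio q N (D0 t t01).
pose dF (t : R) := - 2 * expR (- q * ln (line_sqr w).[t]) / (line_sqr w).[t] *
     ((repoly q w N).[t] * ((1 + Re w * t) * (Re w * ((q - N%:R) * gbin q N * Re (w ^+ N) * t ^+ N)
       - Im w * ((q - N%:R) * gbin q N * Im (w ^+ N) * t ^+ N))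
     + Im w * t * (Re w * ((q - N%:R) * gbin q N * Im (w ^+ N) * t ^+ N)
       + Im w * ((q - N%:R) * gbin q N * Re (w ^+ N) * t ^+ N))) +
      (impoly q w N).[t] * ((1 + Re w * t) * (Re w * ((q - N%:R) * gbin q N * Im (w ^+ N) * t ^+ N)
       + Im w * ((q - N%:R) * gbin q N * Re (w ^+ N) * t ^+ N))
     - Im w * t * (Re w * ((q - N%:R) * gbin q N * Re (w ^+ N) * t ^+ N)
       - Im w * ((q - N%:R) * gbin q N * Im (w ^+ N) * t ^+ N)))).
have derF t : 0 <= t <= 1 -> is_derive t 1 (line_ratio q w N) (dF t) by exact: der.
have [||c c01] := @MVT R (line_ratio q w N) dF 0 1 ltr01.
- by move=> t; rewrite in_itv/= => /andP[t0 t1]; apply: derF; rewrite !ltW.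
- apply: derivable_within_continuous => t; rewrite in_itv/= => t01.
  by have [] := derF t t01.
have {}c01 : 0 <= c <= 1.
  by move: c01; rewrite in_itv/= => /andP[t0 t1]; rewrite !ltW.
have -> : line_ratio q w N 0 = 1.
  rewrite /line_ratio line_sqrE !mulr0 addr0 expr1n expr0n addr0 ln1 mulr0 expR0 mulr1.
  rewrite /repoly /impoly !horner_sum !big_ord_recl/=.
  rewrite !big1; last 2 first.
  - by move=> k _; rewrite !(hornerM, hornerC, hornerXn) expr0n/= mulr0.
  - by move=> k _; rewrite !(hornerM, hornerC, hornerXn) expr0n/= mulr0.
  rewrite !expr0 /= !mulr1 !addr0 !hornerC.
  by rewrite mulr0 expr1n expr0n addr0.
move=> ->; rewrite subr0 mulr1 /dF normrM.
have Xk k : sqc (w ^+ k) <= (rho ^+ k) ^+ 2 by rewrite sqcX exprAC lerXn2r ?nnegrE ?sqc_ge0 ?sqr_ge0.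
have rk0 k : 0 <= rho ^+ k by rewrite exprn_ge0.
apply: ler_pM => //.
  rewrite normrM normfV normrM normrN.
  rewrite (ger0_norm (ler0n _ 2)) (gtr0_norm (expR_gt0 _)) (gtr0_norm (D0 _ c01)).
  apply: ler_pM; rewrite ?invr_ge0 ?mulr_ge0 ?expR_ge0//; first exact/ltW/D0.
    rewrite ler_pM2l// ler_expR !mulNr lerN2 ler_wpM2l// ler_ln ?posrE ?D0//.
    exact: ge.
  by rewrite lef_pV2 ?posrE ?D0// ge.
have /andP[c0 c1] := c01.
have x1 : `|Re w| <= 1 by apply: le_trans (norm_Re_le rho0 wr) (ltW rho1).
have y1 : `|Im w| <= 1 by apply: le_trans (norm_Im_le rho0 wr) (ltW rho1).
have xc : `|Re w * c| <= 1 by rewrite normrM mulr_ile1// ger0_norm.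
have ge' z : `|z| <= rho ^+ N -> `|(q - N%:R) * gbin q N * z * c ^+ N| <= L * rho ^+ N.
  move=> zr; rewrite normrM -[leRHS]mulr1; apply: ler_pM => //; last first.
    by rewrite ger0_norm ?exprn_ge0// exprn_ile1.
  rewrite normrM; apply: ler_pM => //.
  by rewrite -gbinS normrM ger0_norm.
apply: norm_bracket_le => //.
- by rewrite mulr_ge0// invr_ge0 subr_ge0 ltW.
- exact: mulr_ge0.
- by apply: (@norm_poly_le _ _ _ _ _ (fun k => Re (w ^+ k))) => // k; exact: norm_Re_le.
- by apply: (@norm_poly_le _ _ _ _ _ (fun k => Im (w ^+ k))) => // k; exact: norm_Im_le.
- by rewrite (le_trans (ler_normD _ _))// normr1; lra.
- by rewrite normrM mulr_ile1// ger0_norm.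
- by apply: ge'; exact: norm_Re_le.
- by apply: ge'; exact: norm_Im_le.
Qed.

End binomial_series.

(** * Moments of small perturbations *)

Section approximation.
Context {R : realType}.
Local Notation Re := complex.Re.
Local Notation Im := complex.Im.

Lemma expr_small (rho e : R) : 0 <= rho < 1 -> 0 < e ->
  exists N0, forall N, (N0 <= N)%N -> rho ^+ N <= e.
Proof.
move=> /andP[r0 r1] e0.
have := @cvg_expr R rho; rewrite ger0_norm// => /(_ r1) /cvgrPdist_le /(_ _ e0).
case=> N0 _ h; exists N0 => N /h /=.
by rewrite sub0r normrN ger0_norm ?exprn_ge0.
Qed.

(** Multiplying [line_ratio_diff] by |1 + w|^(2 q) <= 4^q turns the bound on the ratio into one on
    the difference. [N0] may depend on q but is uniform in w. *)
Lemma gbin_sum_approx (q : R) m (rho e : R) : m%:R < q < m.+1%:R ->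
  0 <= rho < 1 -> 0 < e -> exists N0, forall N, (N0 <= N)%N ->
  forall w, sqc w <= rho ^+ 2 ->
  `|sqc (1 + w) `^ q - sqc (gbin_sum q N w)| <= e.
Proof.
move=> mq r01 e0; have /andP[mq0 qm] := mq; have /andP[rho0 rho1] := r01.
have q0 : 0 < q by apply: le_lt_trans mq0.
pose K : R := m.+1%:R ^+ m.+1; pose L := m.+1%:R * `|gbin q m.+1|.
pose B := 2 * expR (- q * ln ((1 - rho) ^+ 2)) / (1 - rho) ^+ 2 *
    (12 * (K * (1 - rho)^-1)) * L * 4 `^ q.
have d0 : 0 < 1 - rho by rewrite subr_gt0.
have B0 : 0 <= B.
  rewrite /B !mulr_ge0 ?expR_ge0 ?invr_ge0 ?powR_ge0 ?exprn_ge0 ?(ltW d0)//.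
have [N1 hN1] := @expr_small rho (e / (B + 1)) r01 (divr_gt0 e0 (ltr_wpDl B0 ltr01)).
exists (maxn N1 m) => N; rewrite geq_max => /andP[N1N mN] w wr.
have gK k : `|gbin q k| <= K.
  by have := norm_gbin_le mq (leq0n _) (leq0n k); rewrite mulr1.
have D0 : 0 < (line_sqr w).[1].
  apply: lt_le_trans (line_sqr_ge r01 wr _); last by rewrite ler01 lexx.
  by rewrite exprn_gt0.
have D4 : (line_sqr w).[1] <= 4 by apply: line_sqr_le r01 wr _; rewrite ler01 lexx.
have -> : sqc (1 + w) = (line_sqr w).[1].
  by rewrite line_sqrE !mulr1 /sqc; case: w {wr D0 D4} => x y /=; rewrite add0r.
have -> : sqc (gbin_sum q N w) = line_ratio q w N 1 * (line_sqr w).[1] `^ q.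
  rewrite /line_ratio /sqc Re_gbin_sum Im_gbin_sum -mulrA.
  by rewrite /powR gt_eqF// -expRD mulNr addNr expR0 mulr1.
rewrite -{1}[_ `^ q]mul1r -mulrBl normrM distrC [`|_ `^ q|]ger0_norm ?powR_ge0//.
have := line_ratio_diff (ltW q0) r01 wr gK (gbinM_le mq mN).
have D4q : (line_sqr w).[1] `^ q <= 4 `^ q by apply: ler_powR_base => //; exact: ltW.
move=> h; apply: le_trans (ler_pM _ _ h D4q) _ => //; first exact: powR_ge0.
have -> : 2 * expR (- q * ln ((1 - rho) ^+ 2)) / (1 - rho) ^+ 2 *
    (12 * (K / (1 - rho)) * (m.+1%:R * `|gbin q m.+1| * rho ^+ N)) * 4 `^ q
    = B * rho ^+ N by rewrite /B /L; ring.
apply: le_trans (ler_wpM2l B0 (hN1 N N1N)) _.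
by rewrite mulrCA ler_piMr ?(ltW e0)// ler_pdivrMr ?mul1r ?lerDl// ltr_wpDl.
Qed.

End approximation.

Section moments.
Context {R : realType} {d : nat}.
Local Notation T := (d.-tuple (measurableTypeR R)).
Local Notation cube := (@unit_cube R d).
Local Notation mean f := (Rintegral (lebesgue_tuple R d) cube f).
Local Notation Re := complex.Re.
Local Notation Im := complex.Im.

(** For n != 0, a translation v with n.v = 1/2 preserves the mean and changes the sign of the
    cosine. *)
Lemma mean_cosZ (n : 'rV[int]_d) :
  mean (fun x : T => cos (2 * pi * dotZR n x)) = (n == 0)%:R.
Proof.
have mD := @measurable_unit_cube R d; have I1 := @lebesgue_unit_cube R d.
have [->|n0] := eqVneq n 0.
  rewrite -[RHS](mean_cst mD I1); apply: eq_Rintegral => x _.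
  rewrite (_ : dotZR 0 x = 0) ?mulr0 ?cos0//.
  by rewrite /dotZR big1// => i _; rewrite mxE mul0r.
have [i ni] : exists i, n 0 i != 0.
  apply/existsP; apply: contraR n0; rewrite negb_exists => /forallP h.
  by apply/eqP/rowP => i; rewrite mxE; apply/eqP; have := h i; rewrite negbK.
pose v (j : 'I_d) : R := if j == i then (2 * (n 0 i)%:~R)^-1 else 0.
have nv : dotv n v = 2^-1.
  rewrite /dotv (bigD1 i)//= /v eqxx big1 ?addr0; last first.
    by move=> j /negbTE ->; rewrite mulr0.
  by rewrite invfM mulrCA divff ?mulr1// intr_eq0.
have pc : Zperiodic (fun x : T => cos (2 * pi * dotZR n x) : R).
  by move=> z x; rewrite dotZR_shift dotv_int cos2pi_int.
have h := mean_cube_shift v (bounded_measurable_cosZ n) pc.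
suff : mean (fun x : T => cos (2 * pi * dotZR n x))
    = - mean (fun x : T => cos (2 * pi * dotZR n x)).
  by rewrite (_ : false%:R = 0 :> R)//; lra.
rewrite -{1}h -mulN1r -(meanZ mD I1); last exact: bounded_measurable_cosZ.
by apply: eq_Rintegral => x _; rewrite dotZR_shift nv cos2pi_half mulN1r.
Qed.

Lemma cexp2piD (s t : R) : cexp2pi (s + t) = cexp2pi s * cexp2pi t.
Proof.
rewrite /cexp2pi mulrDr cosD sinD; apply/eqP; rewrite eq_complex/= eqxx /=.
by rewrite addrC.
Qed.

Lemma cexp2pi0 : cexp2pi (0 : R) = 1.
Proof. by rewrite /cexp2pi mulr0 cos0 sin0. Qed.

Lemma sqc_cexp2pi (t : R) : sqc (cexp2pi t) = 1.
Proof. by rewrite /sqc /= cos2Dsin2. Qed.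

Variables (K : nat) (v : 'I_K -> 'rV[int]_d).

Definition trig (a : 'I_K -> R) (x : T) : R[i] :=
  \sum_i ((a i)%:C)%C * cexp2pi (dotZR (v i) x).

(* A word w stands for one monomial of the expansion of (trig a)^k: it has
   frequency [word_sum w] and coefficient [word_coef a w]. *)
Definition word_sum k (w : {ffun 'I_k -> 'I_K}) : 'rV[int]_d := \sum_j v (w j).
Definition word_coef (a : 'I_K -> R) k (w : {ffun 'I_k -> 'I_K}) : R :=
  \prod_j a (w j).

Lemma dotZR0 (x : T) : dotZR 0 x = 0.
Proof. by rewrite /dotZR big1// => i _; rewrite mxE mul0r. Qed.

Lemma dotZRD (m n : 'rV[int]_d) (x : T) : dotZR (m + n) x = dotZR m x + dotZR n x.
Proof.
by rewrite /dotZR -big_split/=; apply: eq_bigr => i _; rewrite mxE intrD mulrDl.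
Qed.

Lemma dotZRB (m n : 'rV[int]_d) (x : T) : dotZR (m - n) x = dotZR m x - dotZR n x.
Proof. by apply: (addIr (dotZR n x)); rewrite -dotZRD !subrK. Qed.

Lemma trig_expr a k x : trig a x ^+ k =
  \sum_(w : {ffun 'I_k -> 'I_K})
    ((word_coef a w)%:C)%C * cexp2pi (dotZR (word_sum w) x).
Proof.
rewrite -[k in LHS]card_ord -prodr_const /trig.
rewrite (bigA_distr_bigA (fun (_ : 'I_k) i => ((a i)%:C)%C * cexp2pi (dotZR (v i) x))).
apply: eq_bigr => w _; rewrite big_split/=; congr (_ * _).
  by rewrite /word_coef rmorph_prod.
rewrite /word_sum; elim/big_rec2 : _ => [|j y z _ ->]; first by rewrite dotZR0 cexp2pi0.
by rewrite dotZRD cexp2piD.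
Qed.

Lemma Re_trig_expr a k x : Re (trig a x ^+ k) =
  \sum_(w : {ffun 'I_k -> 'I_K}) word_coef a w * cos (2 * pi * dotZR (word_sum w) x).
Proof.
rewrite trig_expr raddf_sum; apply: eq_bigr => w _.
by apply: etrans (Re_mulc _ _) _; rewrite /= mul0r subr0.
Qed.

Lemma Im_trig_expr a k x : Im (trig a x ^+ k) =
  \sum_(w : {ffun 'I_k -> 'I_K}) word_coef a w * sin (2 * pi * dotZR (word_sum w) x).
Proof.
rewrite trig_expr raddf_sum; apply: eq_bigr => w _.
by apply: etrans (Im_mulc _ _) _; rewrite /= mul0r addr0.
Qed.

(** The mean of g^k conj(g)^l for g = [trig a]: by orthogonality only pairs of words of equal
    frequency contribute. *)
Definition moment (a : 'I_K -> R) k l : R :=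
  \sum_(w : {ffun 'I_k -> 'I_K}) \sum_(u : {ffun 'I_l -> 'I_K})
    word_coef a w * word_coef a u * (word_sum w == word_sum u)%:R.

Lemma sqc_gbin_sum_trig q N a x : sqc (gbin_sum q N (trig a x)) =
  \sum_(k < N.+1) \sum_(l < N.+1) gbin q k * gbin q l *
    \sum_(w : {ffun 'I_k -> 'I_K}) \sum_(u : {ffun 'I_l -> 'I_K})
      word_coef a w * word_coef a u *
        cos (2 * pi * dotZR (word_sum w - word_sum u) x).
Proof.
have ReE : Re (gbin_sum q N (trig a x)) = \sum_(k < N.+1) gbin q k * Re (trig a x ^+ k).
  by rewrite /gbin_sum raddf_sum; apply: eq_bigr => k _; rewrite /= Re_mulc /= mul0r subr0.
have ImE : Im (gbin_sum q N (trig a x)) = \sum_(k < N.+1) gbin q k * Im (trig a x ^+ k).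
  by rewrite /gbin_sum raddf_sum; apply: eq_bigr => k _; rewrite /= Im_mulc /= mul0r addr0.
rewrite /sqc ReE ImE !expr2 !big_distrlr /= -big_split/=; apply: eq_bigr => k _.
rewrite -big_split/=; apply: eq_bigr => l _.
rewrite !Re_trig_expr !Im_trig_expr.
rewrite mulrACA [X in _ + X]mulrACA -mulrDr; congr (_ * _).
rewrite !big_distrlr /= -big_split/=; apply: eq_bigr => w _.
rewrite -big_split/=; apply: eq_bigr => u _.
by rewrite dotZRB mulrBr cosB; ring.
Qed.

Lemma mean_sqc_gbin_sum q N a : mean (fun x => sqc (gbin_sum q N (trig a x))) =
  \sum_(k < N.+1) \sum_(l < N.+1) gbin q k * gbin q l * moment a k l.
Proof.
have mD := @measurable_unit_cube R d; have I1 := @lebesgue_unit_cube R d.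
have bc (r : R) n : bounded_measurable (fun x : T => r * cos (2 * pi * dotZR n x)).
  by apply: bounded_measurableM;
    [exact: bounded_measurable_cst|exact: bounded_measurable_cosZ].
under eq_Rintegral do rewrite sqc_gbin_sum_trig.
have bs k l : bounded_measurable (fun x : T =>
    \sum_(w : {ffun 'I_k -> 'I_K}) \sum_(u : {ffun 'I_l -> 'I_K})
      word_coef a w * word_coef a u *
        cos (2 * pi * dotZR (word_sum w - word_sum u) x)).
  by do 2 apply: bounded_measurable_sum => ?; exact: bc.
have bk (r : R) k l : bounded_measurable (fun x : T => r *
    \sum_(w : {ffun 'I_k -> 'I_K}) \sum_(u : {ffun 'I_l -> 'I_K})
      word_coef a w * word_coef a u *
        cos (2 * pi * dotZR (word_sum w - word_sum u) x)).
  by apply: bounded_measurableM => //; exact: bounded_measurable_cst.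
rewrite (mean_sum mD I1); last first.
  by move=> k; apply: bounded_measurable_sum => l; exact: bk.
apply: eq_bigr => k _; rewrite (mean_sum mD I1); last by move=> l; exact: bk.
apply: eq_bigr => l _; rewrite (meanZ mD I1)//; congr (_ * _).
rewrite (mean_sum mD I1); last first.
  by move=> w; apply: bounded_measurable_sum => u; exact: bc.
apply: eq_bigr => w _; rewrite (mean_sum mD I1); last by move=> u; exact: bc.
apply: eq_bigr => u _; rewrite (meanZ mD I1) ?mean_cosZ ?subr_eq0//.
exact: bounded_measurable_cosZ.
Qed.

End moments.

(** * Effect of one sign change on the mean of |1 + g|^(2 q) *)

Section perturbation.
Context {R : realType}.

Lemma lt_of_approx (x1 x2 y1 y2 e : R) : 0 < e -> `|x1 - y1| <= e / 4 ->
  `|x2 - y2| <= e / 4 -> y1 - y2 <= - e -> x1 < x2.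
Proof. by rewrite !ler_norml => e0 /andP[_ h1] /andP[h2 _] h3; lra. Qed.

(* The sum is dominated by its terms of lowest degree (M, l0) and (l0, M); the
   bound Kc makes this uniform in the sequence C. *)
Lemma double_sum_le (C : nat -> R) (D : nat -> nat -> R) M l0 (Kc eps theta : R) N :
  (l0 < M)%N -> (M <= N)%N -> C M * C l0 < 0 ->
  0 <= Kc -> 0 < theta -> 2 * theta <= 1 ->
  (forall k l, 0 <= D k l) -> (forall k l, D k l <= 2 * theta ^+ (k + l)) ->
  2 * eps ^+ (M + l0) <= D M l0 ->
  (forall k l, D k l != 0 -> (M <= k)%N && (l0 <= l)%N || (M <= l)%N && (l0 <= k)%N) ->
  (forall k l, (M <= k)%N -> (l0 <= l)%N -> `|C k * C l| <= Kc * `|C M * C l0|) ->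
  8 * Kc * (2 * theta) ^+ (M + l0).+1 <= eps ^+ (M + l0) ->
  \sum_(k < N.+1) \sum_(l < N.+1) C k * C l * D k l
    <= - (`|C M * C l0| * eps ^+ (M + l0)).
Proof.
move=> lM MN Cneg Kc0 th0 th1 D0 Dle DM Dsupp CK small.
set P := `|C M * C l0|; have P0 : 0 <= P by exact: normr_ge0.
have PE : C M * C l0 = - P by rewrite /P ltr0_norm// opprK.
set t := (2 * theta) ^+ (M + l0).+1.
have t0 : 0 <= t by rewrite exprn_ge0// mulr_ge0// ltW.
(* The main term is twice the claimed bound. The rest is geometric with sum at most 8 Kc P t, which
   [small] bounds by half of the main term; the weights 2^-k 2^-l come from using 2 theta in place
   of theta. *)
pose G k l : R := (if (k == M) && (l == l0) then - (2 * P * eps ^+ (M + l0)) else 0)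
  + 2 * Kc * P * t * (2^-1 ^+ k * 2^-1 ^+ l).
have rest k l : 0 <= 2 * Kc * P * t * (2^-1 ^+ k * 2^-1 ^+ l).
  by rewrite !mulr_ge0// exprn_ge0.
have ptw k l : C k * C l * D k l <= G k l.
  rewrite /G; case: ifPn => [/andP[/eqP -> /eqP ->]|ne].
    apply: (@le_trans _ _ (- (2 * P * eps ^+ (M + l0)))); last by rewrite lerDl.
    by rewrite PE; have := ler_wpM2l P0 DM; lra.
  rewrite add0r; have [->|Dne] := eqVneq (D k l) 0; first by rewrite mulr0 rest.
  (* The mirror term (l0, M) is nonpositive and is dropped; any other nonzero term has degree
     greater than M + l0. *)
  have [/andP[/eqP -> /eqP ->]|ne'] := boolP ((k == l0) && (l == M)).
    apply: le_trans (rest _ _); rewrite mulr_le0_ge0//.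
    by rewrite mulrC ltW.
  have [kl CC] : (M + l0 < k + l)%N /\ `|C k * C l| <= Kc * P.
    have /orP[/andP[h1 h2]|/andP[h1 h2]] := Dsupp _ _ Dne.
      split; last exact: CK.
      move: ne; rewrite negb_and => /orP[] ne0.
        by rewrite -addSn leq_add// ltn_neqAle eq_sym ne0.
      by rewrite -addnS leq_add// ltn_neqAle eq_sym ne0.
    split; last by rewrite mulrC; exact: CK.
    move: ne'; rewrite negb_and addnC => /orP[] ne0.
      by rewrite -addSn leq_add// ltn_neqAle eq_sym ne0.
    by rewrite -addnS leq_add// ltn_neqAle eq_sym ne0.
  have thkl : theta ^+ (k + l) <= t * (2^-1 ^+ k * 2^-1 ^+ l).
    have -> : theta ^+ (k + l) = (2 * theta) ^+ (k + l) * (2^-1 ^+ k * 2^-1 ^+ l).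
      by rewrite -exprD -exprMn mulrAC divff ?mul1r.
    rewrite ler_wpM2r ?mulr_ge0 ?exprn_ge0//.
    by apply: ler_wiXn2l => //; rewrite mulr_ge0// ltW.
  apply: le_trans (ler_norm _) _; rewrite normrM (ger0_norm (D0 _ _)).
  have -> : 2 * Kc * P * t * (2^-1 ^+ k * 2^-1 ^+ l) =
    Kc * P * (2 * (t * (2^-1 ^+ k * 2^-1 ^+ l))) by ring.
  apply: ler_pM => //; apply: le_trans (Dle _ _) _.
  by rewrite ler_wpM2l.
apply: (@le_trans _ _ (\sum_(k < N.+1) \sum_(l < N.+1) G k l)).
  by apply: ler_sum => k _; apply: ler_sum => l _; exact: ptw.
have -> : \sum_(k < N.+1) \sum_(l < N.+1) G k l = - (2 * P * eps ^+ (M + l0)) +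
   2 * Kc * P * t * ((\sum_(k < N.+1) 2^-1 ^+ k) * (\sum_(k < N.+1) 2^-1 ^+ k)).
  rewrite big_distrlr /= mulr_sumr.
  under eq_bigr => k _ do rewrite big_split /= -mulr_sumr.
  rewrite big_split /=; congr (_ + _).
  have lN : (l0 < N.+1)%N by rewrite ltnS (leq_trans (ltnW lM)).
  rewrite (bigD1 (Ordinal (MN : (M < N.+1)%N)))//= [X in _ + X]big1 ?addr0; last first.
    move=> k; rewrite -val_eqE /= => kM; rewrite big1// => l _.
    by rewrite (negbTE kM).
  rewrite (bigD1 (Ordinal lN))//= !eqxx big1 ?addr0//.
  by move=> l; rewrite -val_eqE /= => /negbTE ->.
have h2 : \sum_(k < N.+1) 2^-1 ^+ k <= 2 :> R.
  have := @sum_exprs_le R 2^-1 N.+1.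
  have -> : (1 - 2^-1)^-1 = 2 :> R by field.
  by apply; apply/andP; split; lra.
have h0 : 0 <= \sum_(k < N.+1) 2^-1 ^+ k :> R.
  by apply: sumr_ge0 => k _; rewrite exprn_ge0.
have h4 : (\sum_(k < N.+1) 2^-1 ^+ k) * (\sum_(k < N.+1) 2^-1 ^+ k) <= 4 :> R.
  by rewrite (_ : 4 = 2 * 2); [apply: ler_pM|ring].
have a0 : 0 <= 2 * Kc * P * t by rewrite !mulr_ge0.
have := ler_wpM2l a0 h4; have := ler_wpM2l P0 small; rewrite -/t; lra.
Qed.

Context {d : nat}.
Local Notation T := (d.-tuple (measurableTypeR R)).
Local Notation cube := (@unit_cube R d).
Local Notation mean f := (Rintegral (lebesgue_tuple R d) cube f).
Local Notation Re := complex.Re.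
Local Notation Im := complex.Im.
Variables (K : nat) (v : 'I_K -> 'rV[int]_d) (i0 : 'I_K).

Definition wcount k (w : {ffun 'I_k -> 'I_K}) i : nat := \sum_j (w j == i).

Lemma word_coef_sign eps k (w : {ffun 'I_k -> 'I_K}) :
  word_coef (fun i => eps * (-1) ^+ (i == i0)) w = eps ^+ k * (-1) ^+ wcount w i0 :> R.
Proof.
by rewrite /word_coef big_split/= prodr_const card_ord -prodrXr.
Qed.

Lemma word_coef_cst eps k (w : {ffun 'I_k -> 'I_K}) :
  word_coef (fun=> eps) w = eps ^+ k :> R.
Proof. by rewrite /word_coef prodr_const card_ord. Qed.

(** A pair of words changes sign exactly when [i0] occurs an odd number of times in total, and it
    then contributes twice its value. *)
Lemma moment_diff (eps : R) k l :
  moment v (fun=> eps) k l - moment v (fun i => eps * (-1) ^+ (i == i0)) k l =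
  \sum_(w : {ffun 'I_k -> 'I_K}) \sum_(u : {ffun 'I_l -> 'I_K})
    eps ^+ (k + l) * ((word_sum v w == word_sum v u) &&
      odd (wcount w i0 + wcount u i0)).*2%:R.
Proof.
rewrite /moment -sumrB; apply: eq_bigr => w _; rewrite -sumrB; apply: eq_bigr => u _.
rewrite !word_coef_sign !word_coef_cst mulrACA -!exprD -signr_odd.
by rewrite -muln2 natrM; case: (_ == _); case: (odd _); rewrite /= ?expr0 ?expr1; ring.
Qed.

Lemma trig_Re (a : 'I_K -> R) x :
  Re (trig v a x) = \sum_i a i * cos (2 * pi * dotZR (v i) x).
Proof.
rewrite /trig raddf_sum; apply: eq_bigr => i _.
by apply: etrans (Re_mulc _ _) _; rewrite /= mul0r subr0.
Qed.

Lemma trig_Im (a : 'I_K -> R) x :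
  Im (trig v a x) = \sum_i a i * sin (2 * pi * dotZR (v i) x).
Proof.
rewrite /trig raddf_sum; apply: eq_bigr => i _.
by apply: etrans (Im_mulc _ _) _; rewrite /= mul0r addr0.
Qed.

Lemma sqc_trig_le (a : 'I_K -> R) eps x : 0 <= eps -> (forall i, `|a i| <= eps) ->
  sqc (trig v a x) <= 2 * (K%:R * eps) ^+ 2.
Proof.
move=> e0 ae.
have le1 (c : 'I_K -> R) : (forall i, `|c i| <= 1) -> `|\sum_i a i * c i| <= K%:R * eps.
  move=> c1; apply: le_trans (ler_norm_sum _ _ _) _.
  rewrite mulr_natl -[K in leRHS]card_ord -sumr_const; apply: ler_sum => i _.
  by rewrite normrM -[leRHS]mulr1; apply: ler_pM.
rewrite /sqc trig_Re trig_Im.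
rewrite (_ : 2 * _ = (K%:R * eps) ^+ 2 + (K%:R * eps) ^+ 2); last by ring.
by apply: lerD; rewrite -real_normK ?num_real// ler_sqr ?nnegrE ?mulr_ge0//;
  apply: le1 => i; rewrite ler_norml ?cos_geN1 ?cos_le1 ?sin_geN1 ?sin_le1.
Qed.

Lemma bounded_measurable_sqc_trig (a : 'I_K -> R) :
  bounded_measurable (fun x : T => sqc (1 + trig v a x)).
Proof.
have bR : bounded_measurable (fun x : T => 1 + \sum_i a i * cos (2 * pi * dotZR (v i) x)).
  apply: bounded_measurableD; first exact: bounded_measurable_cst.
  apply: bounded_measurable_sum => i; apply: bounded_measurableM.
    exact: bounded_measurable_cst.
  exact: bounded_measurable_cosZ.
have bI : bounded_measurable (fun x : T => \sum_i a i * sin (2 * pi * dotZR (v i) x)).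
  apply: bounded_measurable_sum => i; apply: bounded_measurableM.
    exact: bounded_measurable_cst.
  exact: bounded_measurable_sinZ.
have := bounded_measurableD (bounded_measurableM bR bR) (bounded_measurableM bI bI).
congr bounded_measurable; apply: funext => x; rewrite -!expr2 /sqc -trig_Re -trig_Im.
by case: (trig v a x) => y z /=; rewrite add0r.
Qed.

Lemma bounded_measurable_sqc_gbin_sum q N (a : 'I_K -> R) :
  bounded_measurable (fun x : T => sqc (gbin_sum q N (trig v a x))).
Proof.
have -> : (fun x : T => sqc (gbin_sum q N (trig v a x))) = (fun x =>
  \sum_(k < N.+1) \sum_(l < N.+1) gbin q k * gbin q l *
    \sum_(w : {ffun 'I_k -> 'I_K}) \sum_(u : {ffun 'I_l -> 'I_K})
      word_coef a w * word_coef a u *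
        cos (2 * pi * dotZR (word_sum v w - word_sum v u) x)).
  by apply: funext => x; exact: sqc_gbin_sum_trig.
apply: bounded_measurable_sum => k; apply: bounded_measurable_sum => l.
apply: bounded_measurableM; first exact: bounded_measurable_cst.
apply: bounded_measurable_sum => w; apply: bounded_measurable_sum => u.
apply: bounded_measurableM; first exact: bounded_measurable_cst.
exact: bounded_measurable_cosZ.
Qed.

(** The second hypothesis confines the effect of the flip to degrees at least (m + 2, l0) up to
    order, and the third makes the lowest degree occur. [eps] is produced before q. *)
Lemma trig_minorant m l0 : (l0 < m.+2)%N ->
  (forall k l (w : {ffun 'I_k -> 'I_K}) (u : {ffun 'I_l -> 'I_K}),
    word_sum v w = word_sum v u -> odd (wcount w i0 + wcount u i0) ->
    (m.+2 <= k)%N && (l0 <= l)%N || (m.+2 <= l)%N && (l0 <= k)%N) ->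
  (exists (w : {ffun 'I_m.+2 -> 'I_K}) (u : {ffun 'I_l0 -> 'I_K}),
    word_sum v w = word_sum v u /\ odd (wcount w i0 + wcount u i0)) ->
  exists2 eps : R, 0 < eps & forall q : R, m%:R < q < m.+1%:R ->
    mean (fun x => sqc (1 + trig v (fun=> eps) x) `^ q) <
    mean (fun x => sqc (1 + trig v (fun i => eps * (-1) ^+ (i == i0)) x) `^ q).
Proof.
move=> lM supp [w0 [u0 [wu0 odd0]]].
have mD := @measurable_unit_cube R d; have I1 := @lebesgue_unit_cube R d.
have K0 : 0 < K%:R :> R by rewrite ltr0n (leq_ltn_trans _ (ltn_ord i0)).
pose n := (m.+2 + l0)%N; pose Kc : R := m.+1%:R ^+ m.+1.
have Kc0 : 0 <= Kc by exact: exprn_ge0.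
(* With eps = 1 / Q, the two summands give the [small] inequality and 2 K eps <= 1 respectively. *)
pose Q : R := 8 * Kc * (2 * K%:R) ^+ n.+1 + 2 * K%:R.
have Q1 : 0 <= 8 * Kc * (2 * K%:R) ^+ n.+1.
  by apply: mulr_ge0; [exact: mulr_ge0|apply: exprn_ge0; exact: mulr_ge0].
have Q0 : 0 < Q by rewrite ltr_wpDl// mulr_gt0.
have e0 : 0 < Q^-1 by rewrite invr_gt0.
exists Q^-1 => // q mq; set eps := Q^-1 in e0 *.
have q0 : 0 < q by case/andP: mq => + _; apply: le_lt_trans.
pose theta := K%:R * eps; have th0 : 0 < theta by exact: mulr_gt0.
have th1 : 2 * theta <= 1.
  by rewrite mulrA /eps ler_pdivrMr// mul1r lerDr.
pose a (i : 'I_K) := eps * (-1) ^+ (i == i0) : R.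
pose D k l := moment v (fun=> eps) k l - moment v a k l.
have Dsum k l : \sum_(w : {ffun 'I_k -> 'I_K}) \sum_(u : {ffun 'I_l -> 'I_K})
    eps ^+ (k + l) * 2 = 2 * theta ^+ (k + l).
  rewrite !sumr_const !card_ffun !card_ord /theta exprMn [in RHS]exprD.
  by rewrite -!natrX -[_ *+ _ *+ _]mulr_natr -[_ *+ _]mulr_natr; ring.
have ek0 k : 0 <= eps ^+ k by rewrite exprn_ge0// ltW.
have small : 8 * Kc * (2 * theta) ^+ n.+1 <= eps ^+ n.
  have -> : 8 * Kc * (2 * theta) ^+ n.+1 = eps ^+ n * (8 * Kc * (2 * K%:R) ^+ n.+1 * eps).
    by rewrite /theta mulrA [(2 * K%:R * eps) ^+ n.+1]exprMn [eps ^+ n.+1]exprSr; ring.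
  by rewrite ler_piMr// /eps ler_pdivrMr// mul1r lerDl mulr_ge0.
have [N hN] : exists2 N, (m.+2 <= N)%N &
   forall b, (forall i, `|b i| <= eps) -> forall x : T,
   `|sqc (1 + trig v b x) `^ q - sqc (gbin_sum q N (trig v b x))|
     <= `|gbin q m.+2 * gbin q l0| * eps ^+ n / 4.
  have e'0 : 0 < `|gbin q m.+2 * gbin q l0| * eps ^+ n / 4.
    rewrite divr_gt0// mulr_gt0 ?exprn_gt0// normr_gt0 mulf_neq0//.
      by rewrite lt_eqF// gbin_lt0.
    by rewrite gt_eqF//; have /andP[mq1 _] := mq; apply: (gbin_gt0 mq1).
  (* Since 2 theta <= 1, |g|^2 <= 2 theta^2 <= 1/2 < (3/4)^2. *)
  have rho01 : 0 <= (3 / 4 : R) < 1 by apply/andP; split; lra.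
  have [N0 hN0] := gbin_sum_approx mq rho01 e'0.
  exists (maxn N0 m.+2); first exact: leq_maxr.
  move=> b be x; apply: (hN0 _ (leq_maxl _ _)).
  apply: le_trans (sqc_trig_le x (ltW e0) be) _.
  have : theta ^+ 2 <= 2^-1 ^+ 2 by rewrite ler_sqr ?nnegrE ?(ltW th0)//; lra.
  by rewrite -/theta; lra.
move=> hb.
have approx b : (forall i, `|b i| <= eps) ->
   `|mean (fun x => sqc (1 + trig v b x) `^ q) -
     mean (fun x => sqc (gbin_sum q N (trig v b x)))|
     <= `|gbin q m.+2 * gbin q l0| * eps ^+ n / 4.
  move=> be.
  have b1 : bounded_measurable (fun x : T => sqc (1 + trig v b x) `^ q).
    apply: bounded_measurable_powR; [exact: ltW|by move=> x; exact: sqc_ge0|].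
    exact: bounded_measurable_sqc_trig.
  have b2 := bounded_measurable_sqc_gbin_sum q N b.
  rewrite -(meanB mD I1 b1 b2); apply: (le_norm_mean mD I1); last exact: hb.
  by apply: bounded_measurableD => //; exact: bounded_measurableN.
have eps_le (i : 'I_K) : `|eps| <= eps by rewrite ger0_norm// ltW.
have a_le i : `|a i| <= eps by rewrite /a mulrC normrMsign ger0_norm// ltW.
have A1 := approx (fun=> eps) eps_le; have A2 := approx _ a_le.
have main : mean (fun x => sqc (gbin_sum q N (trig v (fun=> eps) x))) -
    mean (fun x => sqc (gbin_sum q N (trig v a x)))
    <= - (`|gbin q m.+2 * gbin q l0| * eps ^+ n).
  rewrite !mean_sqc_gbin_sum -sumrB.
  under eq_bigr => k _.
    rewrite -sumrB; under eq_bigr => l _ do rewrite -mulrBr -/(D k l).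
    over.
  have /andP[mq1 _] := mq.
  apply: (@double_sum_le (gbin q) D m.+2 l0 Kc eps theta N) => //.
  - by rewrite pmulr_llt0 ?gbin_lt0// (gbin_gt0 mq1).
  - move=> k l; rewrite /D moment_diff.
    by apply: sumr_ge0 => w _; apply: sumr_ge0 => u _; exact: mulr_ge0.
  - move=> k l; rewrite /D moment_diff -Dsum.
    apply: ler_sum => w _; apply: ler_sum => u _; rewrite ler_wpM2l//.
    by case: (_ && _).
  - rewrite /D moment_diff (bigD1 w0)//= (bigD1 u0)//= wu0 eqxx odd0 /= -addrA.
    rewrite mulrC lerDl addr_ge0// sumr_ge0// => *; last first.
      by apply: sumr_ge0 => *; exact: mulr_ge0.
    exact: mulr_ge0.
  - move=> k l; apply: contraNT => nkl; rewrite /D moment_diff big1// => w _.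
    rewrite big1// => u _.
    have [/andP[/eqP wu odd_]|_] := boolP (_ && _); last by rewrite mulr0.
    by rewrite (supp _ _ _ _ wu odd_) in nkl.
  - move=> k l Mk ll; rewrite normrM [`|gbin q m.+2 * _|]normrM mulrCA.
    apply: ler_pM => //; first exact: le_norm_gbin mq (ltnW (leqnn _)) Mk.
    rewrite [`|gbin q l0|]ger0_norm; last by rewrite ltW// (gbin_gt0 mq1).
    exact: norm_gbin_le.
have e'0 : 0 < `|gbin q m.+2 * gbin q l0| * eps ^+ n.
  rewrite mulr_gt0 ?exprn_gt0// normr_gt0 mulf_neq0//.
    by rewrite lt_eqF// gbin_lt0.
  by rewrite gt_eqF//; have /andP[mq1 _] := mq; apply: (gbin_gt0 mq1).
exact: lt_of_approx e'0 A1 A2 main.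
Qed.

End perturbation.

(** * Minimal integer relations *)

Section integer_relations.
Context {d : nat}.
Implicit Types (s t : seq 'rV[int]_d) (c b : 'rV[int]_d -> int) (Gamma : set 'rV[int]_d).

Lemma nat_least (P : nat -> Prop) : (exists n, P n) ->
  exists2 n, P n & forall k, P k -> (n <= k)%N.
Proof.
move=> [n Pn]; have ex : exists n, `[< P n >] by exists n; exact/asboolP.
by exists (ex_minn ex); case: ex_minnP => k /asboolP Pk kP // j /asboolP; exact: kP.
Qed.

Definition relation s c := \sum_(n <- s) c n = 0 /\ \sum_(n <- s) c n *: n = 0.

Lemma relationB s c b (u v : int) : relation s c -> relation s b ->
  relation s (fun n => u * c n - v * b n).
Proof.
move=> [c0 c1] [b0 b1]; split.
  by rewrite sumrB -!mulr_sumr c0 b0 !mulr0 subr0.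
under eq_bigr do rewrite scalerBl -!scalerA.
by rewrite sumrB -!scaler_sumr c1 b1 !scaler0 subr0.
Qed.

Lemma relation_filter s c : relation s c -> relation [seq n <- s | c n != 0] c.
Proof.
rewrite /relation !big_filter => -[c0 c1]; split.
  rewrite -[RHS]c0 [RHS](bigID (fun n => c n != 0)) /= [X in _ + X]big1 ?addr0//.
  by move=> n; rewrite negbK => /eqP.
rewrite -[RHS]c1 [RHS](bigID (fun n => c n != 0)) /= [X in _ + X]big1 ?addr0//.
by move=> n; rewrite negbK => /eqP ->; rewrite scale0r.
Qed.

Definition full_relation Gamma s c :=
  [/\ uniq s, [set` s] `<=` Gamma, s != [::], {in s, forall n, c n != 0} & relation s c].

Definition weight s c : nat := \sum_(n <- s) `|c n|%N.

(* Minimality of the support makes every relation on s proportional to c;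
   minimality of the weight makes the factor an integer. *)
Definition minimal_relation Gamma s c :=
  [/\ full_relation Gamma s c,
    forall s' c', full_relation Gamma s' c' -> (size s <= size s')%N &
    forall c', full_relation Gamma s c' -> (weight s c <= weight s c')%N].

Lemma exists_minimal_relation Gamma :
  (exists s c, full_relation Gamma s c) -> exists s c, minimal_relation Gamma s c.
Proof.
move=> ex.
have [N [s [c [sc sN]]] Nmin] : exists2 N, (exists s c, full_relation Gamma s c /\ size s = N) &
    forall k, (exists s c, full_relation Gamma s c /\ size s = k) -> (N <= k)%N.
  by apply: nat_least; have [s [c sc]] := ex; exists (size s), s, c.
have [W [c' [sc' cW]] Wmin] : exists2 W, (exists c, full_relation Gamma s c /\ weight s c = W) &
    forall k, (exists c, full_relation Gamma s c /\ weight s c = k) -> (W <= k)%N.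
  by apply: nat_least; exists (weight s c), c.
exists s, c'; split => //.
  by move=> s1 c1 h; rewrite sN; apply: Nmin; exists s1, c1.
by move=> c1 h; rewrite cW; apply: Wmin; exists c1.
Qed.

(** Otherwise the support of b, which misses j, would carry a full relation smaller than s. *)
Lemma relation_vanish Gamma s c b j : minimal_relation Gamma s c ->
  relation s b -> j \in s -> b j = 0 -> {in s, forall n, b n = 0}.
Proof.
move=> [[us sG s0 cs rc] smin _] rb js bj n ns; apply/eqP; apply: contraT => bn.
have full : full_relation Gamma [seq n <- s | b n != 0] b.
  split; first exact: filter_uniq.
  - by move=> k /=; rewrite mem_filter => /andP[_ /sG].
  - rewrite -size_eq0 -lt0n size_filter -has_count; apply/hasP; exists n => //.
  - by move=> k; rewrite mem_filter => /andP[].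
  - exact: relation_filter.
have := smin _ _ full; rewrite leqNgt size_filter.
rewrite -(count_predC (fun n => b n != 0) s) -[X in (X < _)%N]addn0 ltn_add2l.
by rewrite -has_count; have -> // : has (predC (fun n => b n != 0)) s;
  apply/hasP; exists j => //=; rewrite bj eqxx.
Qed.

(** The relation c_j b - b_j c vanishes at j, hence everywhere on s. Subtracting the Euclidean
    quotient times c from b leaves b' with c_j b' = r c and |r| < |c_j|; if r were nonzero, b' would
    be a full relation on s of smaller weight. *)
Lemma minimal_relation_multiple Gamma s c b : minimal_relation Gamma s c ->
  relation s b -> exists u : int, {in s, forall n, b n = u * c n}.
Proof.
move=> minc rb; have [[us sG s0 cs rc] smin wmin] := minc.
have [j js] : exists j, j \in s.
  by case: (s) s0 => // j r _; exists j; rewrite mem_head.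
have cj := cs j js.
have prop n : n \in s -> c j * b n = b j * c n.
  move=> ns; have := @relation_vanish _ _ _ _ j minc (relationB (c j) (b j) rb rc) js.
  by rewrite [b j * c j]mulrC subrr => /(_ erefl n ns) /eqP; rewrite subr_eq0 => /eqP.
exists (b j %/ c j)%Z => n ns.
pose r := (b j %% c j)%Z.
pose b' n := 1 * b n - (b j %/ c j)%Z * c n.
have rb' : relation s b' by exact: relationB.
have b'E k : k \in s -> c j * b' k = r * c k.
  move=> ks; rewrite /b' mul1r mulrBr (prop k ks) {1}(divz_eq (b j) (c j)) -/r; ring.
have r0 : r = 0.
  apply/eqP; apply: contraT => rn0.
  have full : full_relation Gamma s b'.
    split => // k ks; apply: contraNneq rn0 => b'k.
    have := b'E k ks; rewrite b'k mulr0 => /esym/eqP.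
    by rewrite mulf_eq0 (negbTE (cs k ks)) orbF.
  have rlt : (`|r| < `|c j|)%N.
    have := ltz_mod (b j) cj; have := modz_ge0 (b j) cj; rewrite -/r => r_ge0.
    by rewrite -ltz_nat !abszE (ger0_norm r_ge0).
  have lt k : k \in s -> (`|b' k| < `|c k|)%N.
    move=> ks; have cj0 : (0 < `|c j|)%N by rewrite absz_gt0.
    rewrite -(ltn_pmul2l cj0) -abszM b'E// abszM ltn_pmul2r// absz_gt0.
    exact: cs.
  have := wmin _ full; rewrite leqNgt => /negP[]; rewrite /weight.
  rewrite !(perm_big _ (perm_to_rem js)) !big_cons.
  rewrite -addSn leq_add ?lt//.
  rewrite big_seq [leqRHS]big_seq; apply: leq_sum => k /mem_rem ks.
  exact/ltnW/lt.
have := b'E n ns; rewrite r0 mul0r => /eqP; rewrite mulf_eq0 (negbTE cj)/=.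
by rewrite /b' mul1r subr_eq0 => /eqP.
Qed.

(** If all coefficients were even, half of c would be a full relation on s of smaller weight. *)
Lemma minimal_relation_odd Gamma s c : minimal_relation Gamma s c ->
  exists2 j, j \in s & odd `|c j|.
Proof.
move=> minc; have [[us sG s0 cs [c0 c1]] smin wmin] := minc.
have [/hasP[j js oj]|/hasPn even] := boolP (has (fun n => odd `|c n|) s); first by exists j.
pose h n := (c n %/ 2)%Z.
have hE n : n \in s -> c n = 2 * h n.
  move=> ns; rewrite /h mulrC divzK//.
  by rewrite dvdzE /= dvdn2 even.
have full : full_relation Gamma s h.
  split => //.
    by move=> n ns; have := cs n ns; rewrite {1}(hE n ns) mulf_eq0 negb_or => /andP[].
  split.
    apply/eqP; have /eqP := c0; rewrite big_seq (eq_bigr (fun n => 2 * h n)) -?big_seq => [|n /hE//].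
    by rewrite -mulr_sumr mulf_eq0.
  apply/rowP => i; rewrite summxE mxE.
  have /rowP/(_ i) := c1; rewrite summxE mxE => /eqP.
  rewrite big_seq (eq_bigr (fun n => 2 * ((h n *: n) 0 i))) -?big_seq; last first.
    by move=> n ns; rewrite (hE n ns) !mxE mulrA.
  by rewrite -mulr_sumr mulf_eq0 => /eqP.
have [j js] : exists j, j \in s.
  by case: (s) s0 => // j r _; exists j; rewrite mem_head.
have lt k : k \in s -> (`|h k| < `|c k|)%N.
  move=> ks; rewrite (hE k ks) abszM /= mul2n -addnn -[X in (X < _)%N]addn0 ltn_add2l absz_gt0.
  by have := cs k ks; rewrite {1}(hE k ks) mulf_eq0 negb_or => /andP[].
have := wmin _ full; rewrite leqNgt => /negP[]; rewrite /weight.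
rewrite !(perm_big _ (perm_to_rem js)) !big_cons -addSn leq_add ?lt//.
rewrite big_seq [leqRHS]big_seq; apply: leq_sum => k /mem_rem ks.
exact/ltnW/lt.
Qed.

End integer_relations.

Section dependence.
Context {R : realType} {d : nat}.
Implicit Types (Gamma : set 'rV[int]_d).

Lemma clear_denominators k (u : 'rV[rat]_k) : exists (D : int) (z : 'I_k -> int),
  D != 0 /\ forall i, (z i)%:~R = D%:~R * u 0 i.
Proof.
exists (\prod_i denq (u 0 i)), (fun i => numq (u 0 i) * \prod_(j | j != i) denq (u 0 j)).
split; first by apply/prodf_neq0 => i _; rewrite denq_neq0.
move=> i; rewrite [X in X%:~R * _](bigD1 i)//= !intrM numqE; ring.
Qed.

(** The rank of an integer matrix is the same over the rationals and the reals, so a rational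
    dependence exists and its denominators can be cleared. *)
Lemma integer_dependence k (A : 'M[int]_(k, d)) :
  ~~ row_free (map_mx (fun z : int => z%:~R : R) A) ->
  exists2 z : 'I_k -> int, exists i, z i != 0 & \sum_i z i *: row i A = 0.
Proof.
pose AQ : 'M[rat]_(k, d) := map_mx intr A.
have -> : map_mx (fun z : int => z%:~R : R) A = map_mx (@ratr R) AQ.
  by apply/matrixP => i j; rewrite !mxE ratr_int.
rewrite /row_free mxrank_map => nfree.
have : kermx AQ != 0.
  rewrite -mxrank_eq0 mxrank_ker subn_eq0 -ltnNge ltn_neqAle nfree.
  by rewrite rank_leq_row.
move=> /rowV0Pn[u /sub_kermxP uA u0].
have [D [z [D0 zE]]] := clear_denominators u.
have [i ui] : exists i, u 0 i != 0.
  apply/existsP; apply: contraR u0; rewrite negb_exists => /forallP h.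
  by apply/eqP/rowP => i; rewrite mxE; apply/eqP; have := h i; rewrite negbK.
exists z.
  exists i; rewrite -(intr_eq0 rat) zE mulf_neq0// intr_eq0//.
apply/rowP => j; apply: (@intr_inj rat); rewrite summxE mxE rmorph_sum /=.
transitivity (D%:~R * (u *m AQ) 0 j); last by rewrite uA mxE mulr0.
rewrite mxE mulr_sumr; apply: eq_bigr => l _.
by rewrite !mxE intrM zE mulrA.
Qed.

Lemma row_free_free (K : fieldType) k (X : k.-tuple 'rV[K]_d) :
  row_free (\matrix_(i < k) X`_i) -> free X.
Proof.
move=> rf; apply/freeP => z zX i.
have : (\row_j z j) *m (\matrix_(i < k) X`_i) = 0 *m (\matrix_(i < k) X`_i).
  rewrite mul0mx mulmx_sum_row -[RHS]zX; apply: eq_bigr => j _.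
  by rewrite mxE rowK.
by move/(row_free_inj rf) => /rowP/(_ i); rewrite !mxE.
Qed.

Lemma exists_full_relation Gamma : ~ affinely_independent R Gamma ->
  exists s c, full_relation Gamma s c.
Proof.
move=> nindep.
have [n0 [Gn0 [S [uS [SG nfree]]]]] : exists n0, Gamma n0 /\
    exists S : seq 'rV[R]_d, uniq S /\
    ([set` S] `<=` [set map_mx (fun z : int => z%:~R : R) (n - n0) | n in Gamma `\ n0]
     /\ ~ free S).
  apply: contrapT => h; apply: nindep => n0 Gn0 S uS SG.
  by apply: contrapT => nf; apply: h; exists n0; split => //; exists S.
pose f n : 'rV[R]_d := map_mx (fun z : int => z%:~R : R) (n - n0).
have [t tS tG] : exists2 t : seq 'rV[int]_d, S = [seq f n | n <- t] &
    {in t, forall n, Gamma n /\ n <> n0}.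
  elim: S {uS nfree} SG => [|x S IHS] SG; first by exists [::].
  have [|t tS tG] := IHS; first by move=> y yS; apply: SG; rewrite /= inE yS orbT.
  have [n [Gn nn0] nx] := SG x (mem_head _ _).
  exists (n :: t); first by rewrite /= tS -nx.
  by move=> k; rewrite inE => /predU1P[->//|/tG].
have ut : uniq t by move: uS; rewrite tS => /map_uniq.
pose A : 'M[int]_(size t, d) := \matrix_i (t`_i - n0).
have nrf : ~~ row_free (map_mx (fun z : int => z%:~R : R) A).
  apply/negP => rf; apply: nfree; rewrite tS.
  apply: (@row_free_free R (size t) (map_tuple f (in_tuple t))).
  move: rf; congr (row_free _); apply/matrixP => i j; rewrite !mxE /=.
  by rewrite (nth_map 0) // /f !mxE.
have [z [i zi] zA] := integer_dependence nrf.
(* The coefficient at [n0] makes the total 0, turning a linear relation between differences into an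
   affine one. *)
pose c n := if n == n0 then - \sum_i z i
            else \sum_(i < size t) (if t`_i == n then z i else 0).
have n0t : n0 \notin t by apply/negP => /tG[_].
have ct (j : 'I_(size t)) : c t`_j = z j.
  rewrite /c ifF; last by apply: contraNF n0t => /eqP <-; rewrite mem_nth.
  rewrite (bigD1 j)//= eqxx big1 ?addr0// => l lj.
  by rewrite nth_uniq// val_eqE (negbTE lj).
have cn0 : c n0 = - \sum_i z i by rewrite /c eqxx.
have rel : relation (n0 :: t) c.
  split; rewrite big_cons (big_nth 0) big_mkord cn0.
    rewrite [X in _ + X](eq_bigr z); first by rewrite addNr.
    by move=> j _; exact: ct.
  rewrite [X in _ + X](eq_bigr (fun j : 'I_(size t) => z j *: t`_j)); last first.
    by move=> j _; congr (_ *: _); exact: ct.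
  rewrite -[RHS]zA scaleNr scaler_suml -sumrN -big_split/=; apply: eq_bigr => j _.
  by rewrite rowK scalerBr addrC.
exists [seq n <- n0 :: t | c n != 0], c; split.
- by rewrite filter_uniq//= n0t.
- move=> n h.
  have : n \in [seq n <- n0 :: t | c n != 0] by exact: h.
  by rewrite mem_filter inE => /andP[_ /predU1P[->//|/tG[]]].
- rewrite -size_eq0 -lt0n size_filter -has_count; apply/hasP; exists t`_i.
    by rewrite inE mem_nth// orbT.
  by rewrite ct.
- by move=> n; rewrite mem_filter => /andP[].
- exact: relation_filter.
Qed.

Lemma large_not_affinely_independent Gamma :
  (`I_(d + 2) #<= Gamma)%card -> ~ affinely_independent R Gamma.
Proof.
pose V : pointedType := HB.pack 'rV[int]_d (isPointed.Build 'rV[int]_d 0).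
move=> /(@pcard_leP nat V)[f] indep.
have fG k : (k < d + 2)%N -> Gamma (f k) by move=> kd; apply: funS.
have finj k l : (k < d + 2)%N -> (l < d + 2)%N -> f k = f l -> k = l.
  by move=> kd ld; apply: inj; rewrite inE.
pose g n : 'rV[R]_d := map_mx (fun z : int => z%:~R : R) (n - f 0%N).
have ginj : injective g.
  move=> m n /matrixP gmn; apply: (addIr (- f 0%N)); apply/matrixP => i k.
  by have := gmn i k; rewrite !mxE => /intr_inj.
pose S := [seq g (f k) | k <- iota 1 d.+1].
have ltk k : k \in iota 1 d.+1 -> (0 < k)%N && (k < d + 2)%N.
  by rewrite mem_iota add1n addn2.
have uS : uniq S.
  rewrite map_inj_in_uniq ?iota_uniq// => k l /ltk/andP[_ kd] /ltk/andP[_ ld] /ginj.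
  exact: finj.
have d0 : (0 < d + 2)%N by rewrite addn2.
have := indep (f 0%N) (fG 0%N d0) S uS.
have SG : [set` S] `<=` [set map_mx (fun z : int => z%:~R : R) (n - f 0%N) | n in Gamma `\ f 0%N].
  move=> x /mapP[k /ltk/andP[k0 kd] ->]; exists (f k) => //; split; first exact: fG.
  by move=> /(finj _ _ kd d0) k00; rewrite k00 in k0.
move=> /(_ SG) /eqP dimS.
have : (\dim <<S>> <= d)%N.
  by apply: leq_trans (dimvS (subvf _)) _; rewrite dimvf dim_matrix mul1r.
by rewrite dimS size_map size_iota ltnn.
Qed.

End dependence.

Section words.
Variable K : nat.

Lemma wcount_sum k (w : {ffun 'I_k -> 'I_K}) : (\sum_i wcount w i = k)%N.
Proof.
rewrite /wcount exchange_big /= (eq_bigr (fun=> 1%N)) ?sum1_card ?card_ord// => j _.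
rewrite (bigD1 (w j))//= eqxx big1 ?addn0// => i iw.
by rewrite eq_sym (negbTE iw).
Qed.

Lemma word_sum_wcount d (v : 'I_K -> 'rV[int]_d) k (w : {ffun 'I_k -> 'I_K}) :
  word_sum v w = \sum_i (wcount w i)%:Z *: v i.
Proof.
rewrite /word_sum /wcount.
under [RHS]eq_bigr => i _ do rewrite -natz natr_sum scaler_suml.
rewrite exchange_big /=; apply: eq_bigr => j _.
rewrite (bigD1 (w j))//= eqxx scale1r big1 ?addr0// => i iw.
by rewrite eq_sym (negbTE iw) scale0r.
Qed.

Lemma word_exists (m : 'I_K -> nat) k : (\sum_i m i = k)%N ->
  exists w : {ffun 'I_k -> 'I_K}, forall i, wcount w i = m i.
Proof.
move=> mk; pose s := flatten [seq nseq (m i) i | i <- enum 'I_K].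
have sz : size s == k.
  rewrite /s size_flatten /shape -map_comp sumnE big_map big_enum /= -mk.
  by apply/eqP; apply: eq_bigr => i _; rewrite size_nseq.
exists [ffun j => tnth (Tuple sz) j] => i.
rewrite /wcount; under eq_bigr do rewrite ffunE.
rewrite -(big_tuple _ _ (Tuple sz) xpredT (fun x => (x == i) : nat)) /=.
rewrite -big_mkcond /= sum1_count /s count_flatten -map_comp sumnE big_map big_enum /=.
rewrite (bigD1 i)//= count_nseq /= eqxx mul1n big1 ?addn0// => j ji.
by rewrite count_nseq /= (negbTE ji) mul0n.
Qed.

End words.

(** * From a minimal relation to the counterexample *)

Section counterexample.
Context {R : realType} {d : nat}.
Local Notation T := (d.-tuple (measurableTypeR R)).
Local Notation cube := (@unit_cube R d).
Local Notation mean f := (Rintegral (lebesgue_tuple R d) cube f).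

Definition posz_part (z : int) : nat := if z is Posz n then n else 0.
Definition negz_part (z : int) : nat := if z is Negz n then n.+1 else 0.

Lemma int_parts (z : int) : z = (posz_part z)%:Z - (negz_part z)%:Z.
Proof. by case: z => n /=; rewrite ?subr0// sub0r NegzE. Qed.

Lemma odd_parts (z : int) : odd (posz_part z + negz_part z) = odd `|z|.
Proof. by case: z => n //=; rewrite addn0. Qed.

(** The positive part of a - b is at most a and equals u times that of z; likewise for the negative
    part and b. *)
Lemma parts_le (z : int) (u : int) (a b : nat) : 0 < u ->
  a%:Z - b%:Z = u * z -> (posz_part z <= a)%N && (negz_part z <= b)%N.
Proof.
case: u => // -[//|u] _; case: z => n /=.
  rewrite leq0n andbT => h.
  have : (a%:Z = (u.+1 * n)%:Z + b%:Z) by rewrite PoszM -h subrK.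
  move/eqP; rewrite -PoszD => /eqP [->].
  by rewrite (leq_trans _ (leq_addr _ _))// leq_pmull.
move=> h.
have : (b%:Z = (u.+1 * n.+1)%:Z + a%:Z).
  by move: h; rewrite PoszM NegzE mulrN => h; rewrite -[X in X + _]opprK -h opprB subrK.
rewrite -PoszD => -[->].
by rewrite (leq_trans _ (leq_addr _ _))// leq_pmull.
Qed.

Lemma majorant_counterexample (Gamma : set 'rV[int]_d) : ~ affinely_independent R Gamma ->
  exists (m : nat) (a : 'rV[int]_d -> R),
    finitely_supported Gamma a /\
    forall p : R, (2 * m)%:R < p < (2 * m + 2)%:R ->
      (cube_Lnorm p (exp_sum Gamma (fun n => `|a n|)%R)
       < cube_Lnorm p (exp_sum Gamma a))%E.
Proof.
move=> /exists_full_relation/exists_minimal_relation[s [c minc]].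
have [[us sG s0 cs [c0 c1]] _ _] := minc.
have [n0 n0s cn0] : exists2 n0, n0 \in s & c n0 < 0.
  apply: contrapT => h.
  have cpos n : n \in s -> 0 <= c n.
    by move=> ns; rewrite leNgt; apply/negP => cn; apply: h; exists n.
  have [j js] : exists j, j \in s.
    by case: (s) s0 => // j r _; exists j; rewrite mem_head.
  have := cs j js; have := c0; rewrite (perm_big _ (perm_to_rem js)) big_cons /=.
  move=> /eqP; rewrite paddr_eq0; last 2 first.
  - exact: cpos.
  - by rewrite big_seq sumr_ge0// => k /mem_rem; exact: cpos.
  by case/andP => ->.
pose t := rem n0 s.
have ut : uniq t by exact: rem_uniq.
have tE n : (n \in t) = (n != n0) && (n \in s) by rewrite mem_rem_uniq// inE.
(* The coefficients sum to 0, so the one at [n0] cannot be the only odd one. *)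
have [j0 j0t oj0] : exists2 j, j \in t & odd `|c j|.
  have [j js oj] := minimal_relation_odd minc.
  have [jn0|jn0] := eqVneq j n0; last by exists j; rewrite ?tE ?jn0.
  apply: contrapT => h.
  have even n : n \in t -> ~~ odd `|c n|.
    by move=> nt; apply/negP => on; apply: h; exists n.
  have : (2 %| \sum_(n <- t) c n)%Z.
    rewrite big_seq.
    apply: (big_ind (fun z => z \in dvdz 2)) => [|x y|n nt]; [exact: rpred0|exact: rpredD|].
    by rewrite dvdzE /= dvdn2 even.
  have : \sum_(n <- t) c n = - c n0.
    by apply/eqP; rewrite -addr_eq0 addrC -[X in X == _](big_cons _ _ _ _ xpredT)
      -(perm_big _ (perm_to_rem n0s)) c0.
  by move=> ->; rewrite dvdzE abszN /= dvdn2 -jn0 oj.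
pose K := size t; pose pt (i : 'I_K) := t`_i.
pose v i := pt i - n0; pose ci i := c (pt i).
have ptt i : pt i \in t by exact: mem_nth.
have sumt (V : zmodType) (F : 'rV[int]_d -> V) :
    \sum_(n <- s) F n = F n0 + \sum_i F (pt i).
  by rewrite (perm_big _ (perm_to_rem n0s)) big_cons (big_nth 0) big_mkord.
have ci_sum : \sum_i ci i = - c n0.
  by apply/eqP; rewrite -addr_eq0 addrC -sumt c0.
have ci_rel : \sum_i ci i *: v i = 0.
  rewrite /v; under eq_bigr do rewrite scalerBr.
  by rewrite sumrB -scaler_suml ci_sum scaleNr opprK addrC -(sumt _ (fun n => c n *: n)) c1.
have mult (b : 'I_K -> int) : \sum_i b i *: v i = 0 ->
    exists u : int, forall i, b i = u * ci i.
  move=> bv.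
  pose b' n := if n == n0 then - \sum_i b i
            else \sum_(i < K) (if pt i == n then b i else 0).
  have ptn0 i : (pt i == n0) = false.
    by have := ptt i; rewrite tE => /andP[/negbTE].
  have b'pt i : b' (pt i) = b i.
    rewrite /b' ptn0 (bigD1 i)//= eqxx big1 ?addr0// => l li.
    by rewrite /pt nth_uniq// val_eqE (negbTE li).
  have b'n0 : b' n0 = - \sum_i b i by rewrite /b' eqxx.
  have rb : relation s b'.
    split; rewrite sumt b'n0.
      by rewrite [X in _ + X](eq_bigr b) ?addNr.
    rewrite [X in _ + X](eq_bigr (fun i => b i *: pt i)); last first.
      by move=> i _; rewrite b'pt.
    rewrite -[RHS]bv scaleNr scaler_suml -sumrN -big_split/=; apply: eq_bigr => j _.
    by rewrite scalerBr addrC.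
  have [u uP] := minimal_relation_multiple minc rb.
  exists u => i; rewrite -b'pt; apply: uP.
  by have := ptt i; rewrite tE => /andP[].
have [i0 oi0] : exists i0, odd `|ci i0|.
  move: j0t => /(nthP 0)[i it ij]; exists (Ordinal it).
  by rewrite /ci /pt /= ij.
pose M := (\sum_i posz_part (ci i))%N; pose l0 := (\sum_i negz_part (ci i))%N.
have Ml0 : (M%:Z - l0%:Z = - c n0).
  rewrite -ci_sum /M /l0 -!natz !natr_sum -sumrB; apply: eq_bigr => i _.
  by rewrite !natz -int_parts.
have lM : (l0 < M)%N by rewrite -ltz_nat -subr_gt0 Ml0 oppr_gt0.
(* M = 1 would force l0 = 0 and a single nonzero coefficient, equal to 1, hence [v i0 = 0] and
   [pt i0 = n0]. *)
have [m Mm] : exists m, M = m.+2.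
  case EM : M lM => [|[|m]] //; last by exists m.
  rewrite ltnS leqn0 => /eqP l00; exfalso.
  have ci0 i : ci i = (posz_part (ci i))%:Z.
    rewrite {1}[ci i]int_parts (_ : negz_part _ = 0%N) ?subr0//.
    by move/eqP: l00; rewrite /l0 sum_nat_eq0 => /forallP/(_ i)/eqP.
  have pi0 : (0 < posz_part (ci i0))%N.
    by move: oi0; rewrite ci0; case: posz_part.
  have rest0 i : i != i0 -> posz_part (ci i) = 0%N.
    move=> ii0; move: EM; rewrite /M (bigD1 i0)//= (bigD1 i)//=.
    by case: (posz_part (ci i0)) pi0 => // -[|?] _; case: (posz_part (ci i)).
  have p1 : posz_part (ci i0) = 1%N.
    move: EM; rewrite /M (bigD1 i0)//= big1 ?addn0//.
  have := ci_rel; rewrite (bigD1 i0)//= big1 ?addr0.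
    rewrite ci0 p1 scale1r /v => /eqP; rewrite subr_eq0 => /eqP ptn0.
    by have := ptt i0; rewrite tE ptn0 eqxx.
  by move=> i ii0; rewrite ci0 rest0// scale0r.
have supp k l (w : {ffun 'I_k -> 'I_K}) (u : {ffun 'I_l -> 'I_K}) :
    word_sum v w = word_sum v u -> odd (wcount w i0 + wcount u i0) ->
    (m.+2 <= k)%N && (l0 <= l)%N || (m.+2 <= l)%N && (l0 <= k)%N.
  move=> wu owu; rewrite -Mm.
  (* The difference of the letter counts is z times [ci]. Oddness at [i0] excludes z = 0, and the
     sign of z decides which word dominates the positive parts. *)
  have [|z zP] := mult (fun i => (wcount w i)%:Z - (wcount u i)%:Z).
    under eq_bigr do rewrite scalerBl.
    by rewrite sumrB -!word_sum_wcount wu subrr.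
  have [z0|z0|z0] := ltgtP z 0.
  - have h i : (posz_part (ci i) <= wcount u i)%N && (negz_part (ci i) <= wcount w i)%N.
      by apply: (@parts_le _ (- z)); [rewrite oppr_gt0|rewrite mulNr -zP opprB].
    apply/orP; right; rewrite -(wcount_sum u) -[in X in _ && X](wcount_sum w).
    by apply/andP; split; apply: leq_sum => i _; case/andP: (h i).
  - have h i : (posz_part (ci i) <= wcount w i)%N && (negz_part (ci i) <= wcount u i)%N.
      exact: parts_le z0 (zP i).
    apply/orP; left; rewrite -(wcount_sum w) -[in X in _ && X](wcount_sum u).
    by apply/andP; split; apply: leq_sum => i _; case/andP: (h i).
  - have := zP i0; rewrite z0 mul0r => /eqP; rewrite subr_eq0 => /eqP [wui].
    by move: owu; rewrite wui addnn odd_double.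
(* The relation itself: one word spells its positive parts, the other its negative parts. *)
have wit : exists (w : {ffun 'I_m.+2 -> 'I_K}) (u : {ffun 'I_l0 -> 'I_K}),
    word_sum v w = word_sum v u /\ odd (wcount w i0 + wcount u i0).
  have [w wP] := word_exists (Mm : (\sum_i posz_part (ci i) = m.+2)%N).
  have [u uP] := word_exists (erefl l0 : (\sum_i negz_part (ci i) = l0)%N).
  exists w, u; split; last by rewrite wP uP odd_parts.
  apply/eqP; rewrite -subr_eq0 !word_sum_wcount -sumrB -[X in _ == X]ci_rel; apply/eqP.
  by apply: eq_bigr => i _; rewrite -scalerBl wP uP -int_parts.
(* The sign of one frequency with odd coefficient in c is flipped, which changes
   exactly the moments indexed by odd multiples of c. *)
rewrite Mm in lM.
have [eps e0 epsP] := @trig_minorant R d K v i0 m l0 lM supp wit.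
pose a n : R := if n \in s then (if n == n0 then 1 else eps * (-1) ^+ (n == pt i0)) else 0.
exists m, a.
split.
  apply: (@sub_finite_set _ _ [set` s]); last exact: finite_seq.
  by move=> n [_]; rewrite /a /=; case: ifP => //; rewrite eqxx.
move=> p /andP[mp pm].
have p0 : 0 < p by apply: le_lt_trans mp.
have a0 n : Gamma n -> n \notin s -> a n = 0 by rewrite /a => _ /negbTE ->.
have A0 n : Gamma n -> n \notin s -> `|a n| = 0 by move=> Gn ns; rewrite a0 ?normr0.
rewrite (cube_Lnorm_exp_sum p0 us sG a0) (cube_Lnorm_exp_sum p0 us sG A0) lte_fin.
apply: gt0_ltr_powR; rewrite ?invr_gt0 ?nnegrE ?mean_tsqr_ge0//.
have tsqrE (b : 'rV[int]_d -> R) (b' : 'I_K -> R) (x : T) :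
    b n0 = 1 -> (forall i, b (pt i) = b' i) ->
    tsqr s b x = sqc (1 + trig v b' x).
  move=> b1 bb'.
  transitivity (sqc (\sum_(n <- s) ((b n)%:C)%C * cexp2pi (dotZR n x))).
    rewrite /tsqr /sqc /tcos /tsin !raddf_sum; congr (_ ^+ 2 + _ ^+ 2).
      apply: eq_bigr => n _; apply: esym; apply: etrans (Re_mulc _ _) _.
      by rewrite /= mul0r subr0.
    apply: eq_bigr => n _; apply: esym; apply: etrans (Im_mulc _ _) _.
    by rewrite /= mul0r addr0.
  rewrite (sumt _ (fun n => ((b n)%:C)%C * cexp2pi (dotZR n x))) b1 mul1r.
  rewrite -[RHS]mul1r -(sqc_cexp2pi (dotZR n0 x)) -sqcM mulrDr mulr1 /trig mulr_sumr.
  congr (sqc (_ + _)); apply: eq_bigr => i _.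
  by rewrite bb' mulrCA -cexp2piD -dotZRD /v addrC subrK.
have q_in : m%:R < p / 2 < m.+1%:R.
  rewrite ltr_pdivlMr// ltr_pdivrMr// -!natrM mulnC mp /=.
  by rewrite mulSn mulnC addnC.
have apt i : a (pt i) = eps * (-1) ^+ (i == i0).
  have := ptt i; rewrite tE /a => /andP[/negbTE -> ->].
  by rewrite /pt nth_uniq// val_eqE.
have an0 : a n0 = 1 by rewrite /a n0s eqxx.
have := epsP _ q_in.
under eq_Rintegral => x _.
  rewrite -(tsqrE (fun n => `|a n|) (fun=> eps)).
  over.
  by rewrite an0 normr1.
  by move=> i; rewrite apt mulrC normrMsign ger0_norm// ltW.
under [X in _ < X -> _]eq_Rintegral => x _.
  rewrite -(tsqrE a (fun i => eps * (-1) ^+ (i == i0)))//.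
  over.
by [].
Qed.

End counterexample.

Theorem theorem1 (R : realType) (d : nat) (d_ge1 : (1 <= d)%N) :
  (forall Gamma : set 'rV[int]_d, Gamma !=set0 ->
     (forall p : R, 0 < p -> strict_majorant Gamma p)
     <-> affinely_independent R Gamma)
  /\
  (forall Gamma : set 'rV[int]_d, ~ affinely_independent R Gamma ->
     exists (m : nat) (a : 'rV[int]_d -> R),
       finitely_supported Gamma a /\
       forall p : R, (2 * m)%:R < p < (2 * m + 2)%:R ->
         (cube_Lnorm p (exp_sum Gamma (fun n => `|a n|)%R)
          < cube_Lnorm p (exp_sum Gamma a))%E)
  /\
  (forall Gamma : set 'rV[int]_d, (`I_(d + 2) #<= Gamma)%card ->
     exists (m : nat) (a : 'rV[int]_d -> R),
       finitely_supported Gamma a /\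
       forall p : R, (2 * m)%:R < p < (2 * m + 2)%:R ->
         (cube_Lnorm p (exp_sum Gamma (fun n => `|a n|)%R)
          < cube_Lnorm p (exp_sum Gamma a))%E).
Proof.
split; last first.
  split=> Gamma; first exact: majorant_counterexample.
  by move=> /(@large_not_affinely_independent R); exact: majorant_counterexample.
move=> Gamma _; split=> [major|indep p]; last first.
  exact: strict_majorant_of_affinely_independent.
apply: contrapT => /majorant_counterexample[m [a [fa lt]]].
(* The exponent 2 m + 1 already refutes the majorant property, applied to a and its absolute
   values. *)
have mp : (2 * m)%:R < ((2 * m + 1)%:R : R) < (2 * m + 2)%:R.
  by rewrite !ltr_nat addn1 addn2 !ltnS !leqnn.
have p0 : 0 < (2 * m + 1)%:R :> R by rewrite ltr0n addn1.
have := lt _ mp; rewrite ltNge => /negP; apply; apply: major => //.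
by rewrite /finitely_supported; under eq_set => n do rewrite normr_eq0.
Qed.
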